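(* Let $n\in\mathbb{N}$, $i\in\{0,\dots,n-1\}$, $j\in\{2,\dots,n\}$ with $j\le n-i$, let $H$ be an $i$-dimensional linear subspace of $\mathbb{R}^n$, and let $\mathcal{B}=\mathcal{K}^n$ or $\mathcal{B}=\mathcal{K}^n_n$. There does not exist a symmetrization $\diamondsuit:\mathcal{B}\to\mathcal{B}_H$ which is monotonic, invariant on $H$-symmetric sets and $V_j$-preserving.
   Context: $\mathcal{K}^n$ is the family of all nonempty compact convex subsets of $\mathbb{R}^n$, and $\mathcal{K}^n_n$ is the family of those with nonempty interior (convex bodies). For a linear subspace $H$, $A|H$ is the orthogonal projection of the set or point $A$ onto $H$. A set is $H$-symmetric if it is invariant under the reflection in $H$, $x\mapsto 2(x|H)-x$. $\mathcal{B}_H$ is the family of all $H$-symmetric members of $\mathcal{B}$. A symmetrization is any map $\diamondsuit:\mathcal{B}\to\mathcal{B}_H$. $\diamondsuit$ is monotonic if $K,L\in\mathcal{B}$, $K\subseteq L$ imply $\diamondsuit K\subseteq\diamondsuit L$. It is invariant on $H$-symmetric sets if $\diamondsuit K=K$ for all $K\in\mathcal{B}_H$. It is $V_j$-preserving if $V_j(\diamondsuit K)=V_j(K)$ for all $K\in\mathcal{B}$, where $V_j$ is the $j$-th intrinsic volume, given (up to a positive normalizing constant, which is irrelevant for being $V_j$-preserving) by $V_j(K)=\binom{n}{j}^{-1}\int_{G_{n,j}}\mathrm{Vol}_E(K|E)\,d\sigma_{n,j}(E)$; here $G_{n,j}$ is the Grassmannian of $j$-dimensional linear subspaces of $\mathbb{R}^n$,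 $\sigma_{n,j}$ its rotation-invariant (Haar) probability measure, and $\mathrm{Vol}_E$ is $j$-dimensional volume in $E$. *)

(* Defs.v *)
From HB Require Import structures.
From mathcomp Require Import all_boot all_order all_algebra.
From mathcomp Require Import all_classical all_reals all_analysis.

Set Implicit Arguments.
Unset Strict Implicit.
Unset Printing Implicit Defensive.

Import Order.TTheory GRing.Theory Num.Theory.
Import numFieldNormedType.Exports.

Local Open Scope classical_set_scope.
Local Open Scope ring_scope.

Section lebesgue_tuple.
Context {R : realType}.
Local Notation Rn n := (n.-tuple (measurableTypeR R)).

Section cons_measure.
Variables (n : nat) (mu : {sigma_finite_measure set (Rn n) -> \bar R}).

Definition cons_pair (p : measurableTypeR R * Rn n) : Rn n.+1 :=
  [tuple of p.1 :: p.2].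

Lemma measurable_cons_pair : measurable_fun [set: _] cons_pair.
Proof. exact: measurable_cons. Qed.

Definition lebesgue_cons : set (Rn n.+1) -> \bar R :=
  pushforward (@lebesgue_measure R \x mu)%E cons_pair.

Let lebesgue_cons0 : lebesgue_cons set0 = 0%E.
Proof. by rewrite /lebesgue_cons /pushforward preimage_set0 measure0. Qed.

Let lebesgue_cons_ge0 A : (0 <= lebesgue_cons A)%E.
Proof. by rewrite /lebesgue_cons /pushforward measure_ge0. Qed.

Let lebesgue_cons_sigma_additive : semi_sigma_additive lebesgue_cons.
Proof.
have := @measure_semi_sigma_additive _ _ _
  (measure_function_pushforward__canonical__measure_function_Measure
     (@lebesgue_measure R \x mu)%E measurable_cons_pair).
exact.
Qed.

HB.instance Definition _ := isMeasure.Build _ _ _ lebesgue_cons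
  lebesgue_cons0 lebesgue_cons_ge0 lebesgue_cons_sigma_additive.

(* The sigma-finiteness instance inferred for m1 \x m2 asks m1 and m2 to be
   finite, hence the direct proof. *)
Let sigma_finite_lebesgue_cons : sigma_finite [set: Rn n.+1] lebesgue_cons.
Proof.
have [F [FT ndF Ffin]] :=
  (sigma_finiteP _ _).1 (sigma_finiteT (@lebesgue_measure R)).
have [G [GT ndG Gfin]] := (sigma_finiteP _ _).1 (sigma_finiteT mu).
pose uncons (t : Rn n.+1) : measurableTypeR R * Rn n :=
  (thead t, [tuple of behead t]).
have unconsK p : uncons (cons_pair p) = p.
  by case: p => x t; congr pair; exact: val_inj.
have muncons : measurable_fun [set: Rn n.+1] uncons.
  apply: measurable_fun_pair; [exact: measurable_tnth|exact: measurable_behead].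
exists (fun k => uncons @^-1` (F k `*` G k)).
  apply/seteqP; split=> // t _.
  have [k _ Fk] : (\bigcup_k F k) (uncons t).1 by rewrite -FT.
  have [l _ Gl] : (\bigcup_k G k) (uncons t).2 by rewrite -GT.
  exists (maxn k l) => //; split.
    by move: Fk; exact/subsetPset/ndF/leq_maxl.
  by move: Gl; exact/subsetPset/ndG/leq_maxr.
move=> k; have [mF finF] := Ffin k; have [mG finG] := Gfin k; split.
  by rewrite -[X in measurable X]setTI; apply: muncons => //; exact: measurableX.
rewrite /lebesgue_cons /pushforward -comp_preimage.
rewrite (_ : _ \o _ = id); last by apply/funext => p /=; exact: unconsK.
by rewrite preimage_id product_measure1E// lte_mul_pinfty// ge0_fin_numE.
Qed.

HB.instance Definition _ :=
  Measure_isSigmaFinite.Build _ _ _ lebesgue_cons sigma_finite_lebesgue_cons.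

End cons_measure.

(* Lebesgue measure on R^n, as an n-fold product. *)
Fixpoint lebesgue_tuple (n : nat) : {sigma_finite_measure set (Rn n) -> \bar R} :=
  if n is m.+1 then lebesgue_cons (lebesgue_tuple m)
  else \d_([tuple] : Rn 0).

End lebesgue_tuple.

Section subspaces.
Context {R : realType} {n : nat}.
Implicit Types (E H : {vspace 'rV[R]_n}) (x y z : 'rV[R]_n).

Definition dot x y : R := \sum_k x 0 k * y 0 k.

Lemma dotE x y : dot x y = (x *m y^T) 0 0.
Proof. by rewrite mxE; apply: eq_bigr => k _; rewrite mxE. Qed.

Lemma dot_eq0 x : dot x x = 0 -> x = 0.
Proof.
move=> /eqP; rewrite psumr_eq0 => [/allP x0|k _]; last by rewrite -expr2 sqr_ge0.
apply/rowP => k; rewrite mxE; apply/eqP.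
by have := x0 k (mem_index_enum _); rewrite mulf_eq0 orbb.
Qed.

Definition orthonormal_in E m (B : 'M[R]_(m, n)) : Prop :=
  B *m B^T = 1%:M /\ forall i, row i B \in E.

(* The unique y in E with x - y orthogonal to E, see oprojP. *)
Definition oproj E x : 'rV[R]_n :=
  xget 0 [set y | y \in E /\ forall z, z \in E -> dot (x - y) z = 0].

Definition onbasis E : 'M[R]_(\dim E, n) :=
  xget 0 [set B | orthonormal_in E B].

Lemma mulmx_memv E m (u : 'rV[R]_m) (B : 'M[R]_(m, n)) :
  (forall i, row i B \in E) -> u *m B \in E.
Proof. by move=> BE; rewrite mulmx_sum_row memv_suml// => i _; rewrite memvZ. Qed.

Lemma oproj_exists E x :
  exists y, y \in E /\ forall z, z \in E -> dot (x - y) z = 0.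
Proof.
pose A := \matrix_(k < \dim E) (vbasis E)`_k.
have AE k : row k A \in E by rewrite rowK vbasis_mem// memt_nth.
have EA z : z \in E -> exists c, z = c *m A.
  move=> /coord_vbasis zE; exists (\row_k coord (vbasis E) k z).
  rewrite {1}zE mulmx_sum_row; apply: eq_bigr => k _.
  by rewrite rowK mxE.
have A_inj (c : 'rV_(\dim E)) : c *m A = 0 -> c = 0.
  rewrite mulmx_sum_row => c0; apply/rowP => k; rewrite mxE.
  have /freeP := basis_free (vbasisP E); apply.
  by rewrite -[RHS]c0; apply: eq_bigr => l _; rewrite rowK.
have Gu : A *m A^T \in unitmx.
  rewrite -row_free_unit -kermx_eq0; apply/eqP/row_matrixP => k; rewrite row0.
  apply: A_inj; apply: dot_eq0; rewrite dotE trmx_mul mulmxA -(mulmxA _ A).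
  by rewrite -row_mul mulmx_ker row0 mul0mx mxE.
exists (x *m A^T *m invmx (A *m A^T) *m A); split; first exact: mulmx_memv.
move=> _ /EA[c ->]; rewrite dotE mulmxBl trmx_mul !mulmxA.
by rewrite -(mulmxA _ A) mulmxKV// subrr mxE.
Qed.

Lemma oprojP E x :
  oproj E x \in E /\ forall z, z \in E -> dot (x - oproj E x) z = 0.
Proof. exact: (xgetPex 0 (oproj_exists E x)). Qed.

Lemma onbasis_exists E : exists B : 'M[R]_(\dim E, n), orthonormal_in E B.
Proof.
suff: forall k, (k <= \dim E)%N -> exists B : 'M[R]_(k, n), orthonormal_in E B.
  exact.
elim=> [_|k IH kE].
  by exists 0; split=> [|[]//]; apply/matrixP => -[].
have [B [BB BE]] := IH (ltnW kE).
pose W := (\sum_i <[row i B]>)%VS.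
have [v vE vW] : exists2 v, v \in E & v \notin W.
  apply: contrapT => EW; suff : (E <= W)%VS.
    move=> /dimvS; apply/negP; rewrite -ltnNge (leq_ltn_trans _ kE)//.
    rewrite (leq_trans (dimv_leq_sum _ _ _))// -[leqRHS]card_ord -sum1_card.
    by apply: leq_sum => i _; rewrite dim_vline leq_b1.
  apply/subvP => v vE; apply: contrapT => /negP vW; apply: EW.
  by exists v.
pose w := v - v *m B^T *m B.
have wE : w \in E by rewrite memvB// mulmx_memv.
have wB : w *m B^T = 0 by rewrite mulmxBl -(mulmxA _ B) BB mulmx1 subrr.
have w0 : w != 0.
  apply: contra vW => /eqP/subr0_eq ->; apply: mulmx_memv => i.
  by rewrite memvE (sumv_sup i).
have ww : 0 < dot w w.
  rewrite lt_neqAle eq_sym; apply/andP; split.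
    by apply: contra w0 => /eqP/dot_eq0 ->.
  by apply: sumr_ge0 => i _; rewrite -expr2 sqr_ge0.
pose u := (Num.sqrt (dot w w))^-1 *: w.
have uB : u *m B^T = 0 by rewrite -scalemxAl wB scaler0.
have uu : u *m u^T = 1%:M.
  rewrite [LHS]mx11_scalar linearZ/= -scalemxAr -scalemxAl scalerA mxE -dotE.
  by rewrite -invfM -expr2 sqr_sqrtr ?ltW// mulVf// gt_eqF.
pose C : 'M[R]_(1 + k, n) := col_mx u B.
have CC : C *m C^T = 1%:M.
  have Bu : B *m u^T = 0 by rewrite -[LHS]trmxK trmx_mul trmxK uB trmx0.
  by rewrite tr_col_mx mul_col_row uu uB Bu BB [RHS]scalar_mx_block.
have CE (i : 'I_(1 + k)) : row i C \in E.
  rewrite -[i]splitK; case: (fintype.split i) => l /=; last by rewrite rowKd.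
  by rewrite rowKu row_id memvZ.
by exists C.
Qed.

Lemma onbasisP E : orthonormal_in E (onbasis E).
Proof. exact: (xgetPex 0 (onbasis_exists E)). Qed.

End subspaces.

HB.instance Definition _ (K : fieldType) (vT : vectType K) :=
  isPointed.Build {vspace vT} 0%VS.

Section intrinsic_volume.
Context {R : realType} {n : nat}.
Implicit Types (E H : {vspace 'rV[R]_n}) (x : 'rV[R]_n) (K : set 'rV[R]_n).

(* The j-dimensional volume in E is computed in the coordinates of an
   orthonormal basis; it is meant for subsets S of E. *)
Definition Vol E (S : set 'rV[R]_n) : \bar R :=
  lebesgue_tuple (\dim E)
    [set t | S ((\row_k tnth t k) *m onbasis E)].

Definition oproj_mx E : 'M[R]_n := lin1_mx (oproj E).

(* All linear subspaces of R^n, with the topology for which E |-> (matrix of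
   the projection onto E) is an embedding, and the Borel sigma-algebra of that
   topology.  The measurable spaces of the library are pointed, so sigma_{n,j}
   is a probability on all subspaces, concentrated on G_{n,j}. *)
Definition subspaces := initial_topology oproj_mx.
Definition borel_subspaces :=
  g_sigma_algebraType (@open subspaces).

Definition grassmannian (j : nat) : set {vspace 'rV[R]_n} :=
  [set E | \dim E = j].

Definition rotation (g : 'M[R]_n) : Prop := g *m g^T = 1%:M /\ \det g = 1.

Definition rotate (g : 'M[R]_n) E : {vspace 'rV[R]_n} :=
  (linfun (mulmxr g) @: E)%VS.

Definition haar_grassmannian (j : nat) (sigma : probability borel_subspaces R) :
    Prop :=
  sigma (grassmannian j) = 1%E /\
  forall g, rotation g -> forall A : set borel_subspaces, measurable A ->
    sigma (rotate g @^-1` A) = sigma A.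

Definition intrinsic_volume (sigma : probability borel_subspaces R) (j : nat) K :
    \bar R :=
  ((('C(n, j))%:R^-1)%:E *
   \int[sigma]_(E in (grassmannian j : set borel_subspaces))
     Vol E (oproj E @` K))%E.

Definition compact_convex K : Prop :=
  [/\ K !=set0, compact K & convex_set (K : set (convex_lmodType 'rV[R]_n))].

Definition convex_body K : Prop := compact_convex K /\ interior K !=set0.

Definition reflection H x : 'rV[R]_n := 2 *: oproj H x - x.

Definition symmetric_wrt H K : Prop := reflection H @` K = K.

(* A map B -> B_H is represented by a function on all sets, of which only the
   values on B matter. *)
Definition symmetrization (B : set (set 'rV[R]_n)) H
    (F : set 'rV[R]_n -> set 'rV[R]_n) : Prop :=
  forall K, B K -> B (F K) /\ symmetric_wrt H (F K).

Definition monotonic (B : set (set 'rV[R]_n))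
    (F : set 'rV[R]_n -> set 'rV[R]_n) : Prop :=
  forall K L, B K -> B L -> K `<=` L -> F K `<=` F L.

Definition invariant_on_symmetric (B : set (set 'rV[R]_n)) H
    (F : set 'rV[R]_n -> set 'rV[R]_n) : Prop :=
  forall K, B K -> symmetric_wrt H K -> F K = K.

Definition preserving (V : set 'rV[R]_n -> \bar R) (B : set (set 'rV[R]_n))
    (F : set 'rV[R]_n -> set 'rV[R]_n) : Prop :=
  forall K, B K -> V (F K) = V K.

End intrinsic_volume.

Arguments borel_subspaces : clear implicits.

(* Main.v *)
Require Import Defs.
From mathcomp Require Import all_boot all_order all_algebra.
From mathcomp Require Import all_classical all_reals all_analysis.
From mathcomp Require Import perm measurable_realfun.
From mathcomp Require Import ring lra.

Set Implicit Arguments.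
Unset Strict Implicit.
Unset Printing Implicit Defensive.

Import Order.TTheory GRing.Theory Num.Theory.
Import numFieldNormedType.Exports.

Local Open Scope classical_set_scope.
Local Open Scope ring_scope.

(** Let [F] be such a symmetrization and let [P] be a frame of [j = m.+2] vectors
    orthogonal to [H], which the reflection in [H] negates. The idea is that [F] acts
    on chords orthogonal to [H] at least as Steiner symmetrization does, and that this
    makes some body grow.

    Chords. Consider a thin tube around the chord from [- p *: v] to [q *: v], with
    [0 <= p <= q] and [v] orthogonal to [H]. It lies in the tube around the chord from
    [- q *: v] to [q *: v], which is [H]-symmetric and hence fixed by [F]; by
    monotonicity the image of the first tube lies in the second. As the intrinsic
    volume is preserved, the image cannot stay in the middle part of half length [b]
    with [2 * b < p + q]. So it reaches distance [(p + q) / 2] up to the thickness of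
    the tube, on both sides by symmetry. Hence, if a body [K] contains tubes around the
    chord, then [F K] contains [b *: v] and [- b *: v] for all [b < (p + q) / 2]
    (lemma [chord_point]).

    The body. Let [T] be the triangle with vertices [(1, 0)], [(0, 1)], [(-1, -1)]. The
    chord through the vertex [a] and the centroid [0] runs from [- a / 2] to [a], so
    the image contains [b *: a] and [- b *: a] for [b < 3 / 4]; the proof takes
    [b = 5 / 7]. These six points span a hexagon whose area is [50 / 49] times that of
    the triangle. In dimension [m.+2] the triangle is replaced by an iterated double
    cone over it; the new axes are symmetric chords, which [F] leaves alone, and the
    ratio of the volumes is unchanged ([hexagon_hull], [leb_hexagon_triangle]). The
    image of the body under [F] thus contains a set with a strictly larger volume.

    Intrinsic volumes. For sets [linear_image P X], the [j]-th intrinsic volume is a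
    positive finite multiple of the [j]-dimensional volume of [X]
    ([intrinsic_volume_linear]): on every subspace [E], the map from [X] to the
    projection of [linear_image P X] multiplies volumes by a constant, and this
    constant is positive on a set of subspaces of positive Haar measure, since
    otherwise rotations would make it vanish for every frame, and finitely many
    coordinate frames suffice for all subspaces ([transversal_measure]).

    Thickening. The sets [linear_image P X] have empty interior when [j < n]. To treat
    convex bodies as well, they are summed with an [H]-symmetric zonotope of size
    [1 / N]; this changes the intrinsic volume by a multiple of [1 / N] at most
    ([intrinsic_volume_add_zonotope]), and the contradiction is reached for large
    [N]. *)

(** * Lebesgue measure of sets of row vectors *)

Section row_measure.
Context {R : realType}.
Local Notation Rn n := (n.-tuple (measurableTypeR R)).

Definition row_of n (t : Rn n) : 'rV[R]_n := \row_k tnth t k.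
Definition tuple_of n (x : 'rV[R]_n) : Rn n := [tuple x 0 k | k < n].

Lemma tuple_ofK n : cancel (@tuple_of n) (@row_of n).
Proof. by move=> x; apply/rowP => k; rewrite mxE tnth_mktuple. Qed.

(** Volumes are moved from tuples to row vectors, on which matrices act. *)
Definition leb n (S : set 'rV[R]_n) : \bar R := lebesgue_tuple n (@row_of n @^-1` S).

Definition mrow n (S : set 'rV[R]_n) : Prop := measurable (@row_of n @^-1` S).

Lemma mrow_coord n (k : 'I_n) (A : set R) :
  measurable (A : set (measurableTypeR R)) -> mrow [set x : 'rV[R]_n | A (x 0 k)].
Proof.
move=> mA; rewrite /mrow.
rewrite (_ : _ @^-1` _ = (fun t : Rn n => tnth t k) @^-1` A).
  by rewrite -[X in measurable X]setTI; exact: measurable_tnth.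
by apply/seteqP; split=> t /=; rewrite mxE.
Qed.

Lemma invS_lt (e : R) : 0 < e -> exists N, N.+1%:R^-1 < e.
Proof.
move=> e0; have /archimedean.Num.Theory.archi_boundP : 0 <= e^-1 by rewrite invr_ge0 ltW.
set N := archimedean.Num.Def.archi_bound _ => NE; exists N.
rewrite invf_plt ?posrE ?ltr0Sn//.
by apply: (lt_le_trans NE); rewrite ler_nat.
Qed.

(** An open set is a countable union of closed cubes with rational centres. *)
Lemma mrow_open n (S : set 'rV[R]_n) : open S -> mrow S.
Proof.
move=> oS; pose I := ('rV[rat]_n * nat)%type.
pose cube (i : I) := [set x : 'rV[R]_n |
  forall k, `|x 0 k - ratr (i.1 0 k)| <= i.2.+1%:R^-1].
have -> : S = \bigcup_i [set x | cube i `<=` S /\ cube i x].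
  apply/seteqP; split=> [x Sx|x [i _]]; last by case=> iS /iS.
  have [e /= e0 eS] : exists2 e : R, 0 < e & ball x e `<=` S.
    by have /nbhs_ballP[e e0 eS] := open_nbhs_nbhs (conj oS Sx); exists e.
  have [N NE] := invS_lt (divr_gt0 e0 (ltr0Sn R 1)).
  have N0 : 0 < N.+1%:R^-1 :> R by rewrite invr_gt0.
  have /choice[q qP] (k : 'I_n) : exists q : rat, `|x 0 k - ratr q| < N.+1%:R^-1.
    have [q] : exists q : rat, ratr q \in `]x 0 k, x 0 k + N.+1%:R^-1[.
      by apply: rat_in_itvoo; rewrite ltrDl.
    move: (N.+1%:R^-1) N0 => d d0; rewrite in_itv/= => /andP[q1 q2]; exists q.
    by rewrite ltr_distl; apply/andP; split; lra.
  exists (\row_k q k, N) => //; split=> [|k /=]; last by rewrite mxE ltW.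
  move=> y /= yq; apply: eS; split=> // i k; rewrite ord1.
  rewrite /ball/= (le_lt_trans (ler_distD (ratr (q k)) _ _))//.
  have := yq k; rewrite /= mxE (distrC (y 0 k)) => y1; have := qP k.
  move: (N.+1%:R^-1) NE y1 => d dE y1; lra.
rewrite /mrow preimage_bigcup.
apply: countable_bigcupT_measurable => [|i]; first exact: countableP.
have [iS|iS] := pselect (cube i `<=` S); last first.
  by rewrite (_ : _ @^-1` _ = set0)// -subset0 => t [].
rewrite (_ : _ @^-1` _ = \bigcap_(k in [set: 'I_n])
   (@row_of n @^-1` [set x | `[ratr (i.1 0 k) - i.2.+1%:R^-1, ratr (i.1 0 k) + i.2.+1%:R^-1]%classic (x 0 k)])).
  apply: fin_bigcap_measurable => // k _; apply: mrow_coord; exact: measurable_itv.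
apply/seteqP; split => t /= => [[_ ti] k _|ti]; last (split=> // k; move: (ti k Logic.I)).
  by have := ti k; rewrite /= in_itv/= ler_distl.
by rewrite /= in_itv/= ler_distl.
Qed.

Lemma mrow_closed n (S : set 'rV[R]_n) : closed S -> mrow S.
Proof.
move=> cS; rewrite /mrow -[S]setCK preimage_setC; apply: measurableC.
by apply: (@mrow_open _ (~` S)); rewrite openC.
Qed.

Definition tuple_add n (v : 'rV[R]_n) (t : Rn n) : Rn n := tuple_of (row_of t + v).

Lemma measurable_tuple_add n v : measurable_fun setT (@tuple_add n v).
Proof.
apply/measurable_fun_tnthP => k.
rewrite (_ : _ \o _ = (fun t : Rn n => (tnth t k + v 0 k : measurableTypeR R))); last first.
  by apply/funext => t; rewrite /= tnth_mktuple !mxE.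
apply: measurable_funD => //; exact: measurable_tnth.
Qed.

Lemma lebesgue_measure_add (v : R) (A : set (measurableTypeR R)) : measurable A ->
  lebesgue_measure ((fun x : measurableTypeR R => x + v : measurableTypeR R) @^-1` A) =
  lebesgue_measure A.
Proof.
move=> mA; have mv : measurable_fun setT (fun x : measurableTypeR R => x + v : measurableTypeR R).
  exact: measurable_funD.
apply/esym; apply: (lebesgue_measure_unique
  (mu := measure_function_pushforward__canonical__measure_function_Measure lebesgue_measure mv)) => //.
move=> _ [[a b]] _ <-; rewrite /= /pushforward.
rewrite (_ : _ @^-1` _ = `]a - v, b - v]%classic); last first.
  by apply/seteqP; split => x /=; rewrite !in_itv/= ltrBlDr lerBrDr.
rewrite !lebesgue_measure_itv/= !lte_fin ltrD2r; case: ifP => // _.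
by rewrite -!EFinB; congr EFin; ring.
Qed.

(** By uniqueness of product measures it suffices to translate rectangles, which is
    the case of the line together with the induction hypothesis. *)
Lemma lebesgue_tuple_add n (v : 'rV[R]_n) (A : set (Rn n)) : measurable A ->
  lebesgue_tuple n (tuple_add v @^-1` A) = lebesgue_tuple n A.
Proof.
elim: n v A => [|n IH] v A mA.
  rewrite (_ : _ @^-1` _ = A)//; apply/funext => t /=; congr A.
  by rewrite /tuple_add/=; apply: eq_from_tnth; case.
rewrite /= /lebesgue_cons /pushforward.
have mcA : measurable (@cons_pair R n @^-1` A).
  by rewrite -[X in measurable X]setTI; exact: measurable_cons_pair.
pose v' : 'rV[R]_n := \row_k v 0 (lift ord0 k).
pose h (p : measurableTypeR R * Rn n) : measurableTypeR R * Rn n :=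
  (p.1 + v 0 0, tuple_add v' p.2).
have mh : measurable_fun setT h.
  apply: measurable_fun_pair; first exact: measurable_funD.
  exact: measurableT_comp (measurable_tuple_add v') measurable_snd.
rewrite (_ : _ @^-1` _ = h @^-1` (@cons_pair R n @^-1` A)); last first.
  apply/seteqP; split=> p /=; congr A; apply: eq_from_tnth => k;
    rewrite !tnth_mktuple !mxE/=; case: (unliftP ord0 k) => [j ->|->];
    by rewrite ?tnth0 ?tnthS// tnth_mktuple !mxE.
apply/esym; apply: (product_measure_unique (m' :=
  measure_function_pushforward__canonical__measure_function_Measure
     (@lebesgue_measure R \x lebesgue_tuple n)%E mh)) => // B C mB mC.
rewrite /= /pushforward (_ : _ @^-1` _ =
   ((fun x : measurableTypeR R => x + v 0 0 : measurableTypeR R) @^-1` B) `*` (tuple_add v' @^-1` C))//.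
have mB' : measurable ((fun x : measurableTypeR R => x + v 0 0 : measurableTypeR R) @^-1` B).
  by rewrite -[X in measurable X]setTI; apply: measurable_funD.
have mC' : measurable (tuple_add v' @^-1` C).
  by rewrite -[X in measurable X]setTI; exact: measurable_tuple_add.
rewrite product_measure1E// IH//; congr (_ * _)%E.
exact: (lebesgue_measure_add (v 0 0) mB).
Qed.

Lemma mrow_add n v (S : set 'rV[R]_n) : mrow S -> mrow [set x | S (x + v)].
Proof.
move=> mS; rewrite /mrow (_ : _ @^-1` _ = tuple_add v @^-1` (@row_of n @^-1` S)).
  by rewrite -[X in measurable X]setTI; exact: measurable_tuple_add.
by apply/seteqP; split=> t /=; rewrite tuple_ofK.
Qed.

Lemma leb_add n v (S : set 'rV[R]_n) : mrow S -> leb [set x | S (x + v)] = leb S.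
Proof.
move=> mS; rewrite /leb -(lebesgue_tuple_add v mS).
suff -> : @row_of n @^-1` [set x | S (x + v)] = tuple_add v @^-1` (@row_of n @^-1` S) by [].
by apply/seteqP; split=> t /=; rewrite tuple_ofK.
Qed.

End row_measure.

(** * Fubini and linear substitutions *)

Section linear_measure.
Context {R : realType}.
Local Notation Rn n := (n.-tuple (measurableTypeR R)).

Lemma measurable_tuple_of d (T : measurableType d) n (f : T -> 'rV[R]_n) :
  (forall k, measurable_fun setT (fun t => f t 0 k : measurableTypeR R)) ->
  measurable_fun setT (fun t => tuple_of (f t)).
Proof.
move=> mf; apply/measurable_fun_tnthP => k.
rewrite (_ : _ \o _ = (fun t => f t 0 k : measurableTypeR R)); first exact: mf.
by apply/funext => t; rewrite /= tnth_mktuple.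
Qed.

Lemma measurable_coord_linear m n (N : 'M[R]_(m, n)) k :
  measurable_fun setT (fun t : Rn m => (row_of t *m N) 0 k : measurableTypeR R).
Proof.
rewrite (_ : (fun _ => _) = (fun t : Rn m => \sum_l tnth t l * N l k)); last first.
  by apply/funext => t; rewrite mxE; apply: eq_bigr => l _; rewrite mxE.
apply: measurable_sum => l; apply: measurable_funM => //.
exact: measurable_tnth.
Qed.

Lemma measurable_coord m k :
  measurable_fun setT (fun t : Rn m => row_of t 0 k : measurableTypeR R).
Proof.
rewrite (_ : (fun _ => _) = (fun t : Rn m => tnth t k)); last by apply/funext => t; rewrite mxE.
exact: measurable_tnth.
Qed.

Lemma measurable_row_preimage d (T : measurableType d) n (f : T -> 'rV[R]_n) S :
  (forall k, measurable_fun setT (fun t => f t 0 k : measurableTypeR R)) ->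
  mrow S -> measurable [set t | S (f t)].
Proof.
move=> mf mS; rewrite (_ : [set _ | _] = (fun t => tuple_of (f t)) @^-1` (@row_of R n @^-1` S)).
  by rewrite -[X in measurable X]setTI; exact: measurable_tuple_of.
by apply/seteqP; split=> t /=; rewrite tuple_ofK.
Qed.

Lemma mrow_linear m n (N : 'M[R]_(m, n)) S : mrow S -> mrow [set x | S (x *m N)].
Proof.
move=> mS; apply: (@measurable_row_preimage _ (Rn m) n (fun t => row_of t *m N)) mS => k.
exact: measurable_coord_linear.
Qed.

Lemma lebesgue_tuple_Fubini m n (E : 'rV[R]_m -> 'rV[R]_n -> Prop) :
  measurable [set p : Rn m * Rn n | E (row_of p.1) (row_of p.2)] ->
  (\int[lebesgue_tuple m]_t leb [set y | E (row_of t) y] =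
   \int[lebesgue_tuple n]_u leb [set x | E x (row_of u)])%E.
Proof.
move=> mE; transitivity ((lebesgue_tuple m \x lebesgue_tuple n)%E
    [set p : Rn m * Rn n | E (row_of p.1) (row_of p.2)]).
  rewrite /product_measure1; congr integral; apply/funext => t /=; rewrite /leb; congr (lebesgue_tuple _ _).
  by apply/funext => u; rewrite /xsection/= inE.
rewrite (product_measure_unique
  (m' := lebesgue_integral_fubini_product_measure2__canonical__measure_function_Measure
     (lebesgue_tuple m) (lebesgue_tuple n)))//; last first.
  by move=> A B mA mB /=; exact: product_measure2E.
rewrite /= /product_measure2; congr integral; apply/funext => t /=; rewrite /leb; congr (lebesgue_tuple _ _).
by apply/funext => u; rewrite /ysection/= inE.
Qed.

Lemma integral_leb_const n (S : set 'rV[R]_n) (f : Rn n -> \bar R) (c : \bar R) :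
  mrow S -> (0 <= c)%E -> (forall t, S (row_of t) -> f t = c) ->
  (forall t, ~ S (row_of t) -> f t = 0%E) ->
  (\int[lebesgue_tuple n]_t f t = leb S * c)%E.
Proof.
move=> mS c0 fS fnS.
rewrite (eq_integral (fun t => (\1_(@row_of R n @^-1` S) t)%:E * c)%E); last first.
  move=> t _; rewrite indicE; have [tS|/negP tS] := boolP (t \in _).
    by rewrite mul1e fS//; move: tS; rewrite inE.
  by rewrite mul0e fnS//; move: tS; rewrite inE.
rewrite ge0_integralZr ?integral_indic ?setIT//; exact: measurableT_comp.
Qed.

Lemma leb0 n : leb (set0 : set 'rV[R]_n) = 0%E.
Proof. by rewrite /leb preimage_set0 measure0. Qed.

Lemma leb_ge0 n (S : set 'rV[R]_n) : (0 <= leb S)%E.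
Proof. exact: measure_ge0. Qed.

Lemma le_leb n (S T : set 'rV[R]_n) : mrow S -> mrow T -> S `<=` T ->
  (leb S <= leb T)%E.
Proof. by move=> mS mT ST; apply: le_measure; rewrite ?inE// => t /ST. Qed.

(** Both sides are the measure of the pairs [(x, y)] such that [x *m N + y] is in [A]
    and [y] is in [Q]. Integrating over [x] first gives the left-hand side; the right-hand
    side arises from translating [y] by [x *m N] and then integrating over [x]. With a
    fixed cube as [Q] this shows that all volumes are multiplied by the same constant,
    without any formula for that constant. *)
Lemma leb_linear_exchange n (N : 'M[R]_n) (A Q : set 'rV[R]_n) :
  N \in unitmx -> mrow A -> mrow Q ->
  (leb [set x | A (x *m N)%R] * leb Q = leb A * leb [set x | Q (- (x *m N))%R])%E.
Proof.
move=> uN mA mQ.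
have mAN := mrow_linear N mA.
have mQN : mrow [set x | Q (- (x *m N))].
  have := mrow_linear (- N) mQ; congr (mrow _); apply/funext => x.
  by rewrite /= mulmxN.
pose E1 (x y : 'rV[R]_n) := A (x *m N + y) /\ Q y.
pose E2 (x y : 'rV[R]_n) := A y /\ Q (y - x *m N).
have mE1 : measurable [set p : Rn n * Rn n | E1 (row_of p.1) (row_of p.2)].
  apply: measurableI; apply: measurable_row_preimage => // k.
    rewrite [X in measurable_fun _ X](_ : _ = fun p : Rn n * Rn n =>
      ((row_of p.1 *m N) 0 k + row_of p.2 0 k : measurableTypeR R)).
      apply: measurable_funD.
        exact: (measurableT_comp (measurable_coord_linear N k) measurable_fst).
      exact: (measurableT_comp (measurable_coord k) measurable_snd).
    by apply/funext => p; rewrite mxE.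
  exact: (measurableT_comp (measurable_coord k) measurable_snd).
have mE2 : measurable [set p : Rn n * Rn n | E2 (row_of p.1) (row_of p.2)].
  apply: measurableI; apply: measurable_row_preimage => // k.
    exact: (measurableT_comp (measurable_coord k) measurable_snd).
  rewrite [X in measurable_fun _ X](_ : _ = fun p : Rn n * Rn n =>
    (row_of p.2 0 k - (row_of p.1 *m N) 0 k : measurableTypeR R)).
    apply: measurable_funB.
      exact: (measurableT_comp (measurable_coord k) measurable_snd).
    exact: (measurableT_comp (measurable_coord_linear N k) measurable_fst).
  by apply/funext => p; rewrite !mxE.
rewrite [LHS]muleC.
have <- : (\int[lebesgue_tuple n]_u leb [set x | E1 x (row_of u)] =
    leb Q * leb [set x | A (x *m N)%R])%E.
  apply: integral_leb_const => // [u Qu|u nQu].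
  - rewrite -(leb_add (row_of u *m invmx N) mAN); congr leb.
    have uK x : (x + row_of u *m invmx N) *m N = x *m N + row_of u by rewrite mulmxDl mulmxKV.
    by apply/seteqP; split=> [x [] /=|x /=]; rewrite uK.
  - rewrite (_ : [set _ | _] = set0) ?leb0//.
    by rewrite -subset0 => x [].
rewrite -lebesgue_tuple_Fubini//.
rewrite (eq_integral (fun t => leb [set y | E2 (row_of t) y])); last first.
  move=> t _; have mEt : mrow [set y | E2 (row_of t) y].
    by apply: measurableI => //; exact: mrow_add.
  rewrite -[RHS](leb_add (row_of t *m N))//; congr leb.
  by apply/seteqP; split=> x /=; rewrite /E1/E2 addrK addrC.
rewrite lebesgue_tuple_Fubini//; apply: integral_leb_const => // [u Au|u nAu].
- rewrite -(leb_add (- (row_of u *m invmx N)) mQN); congr leb.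
  have uK x : - ((x - row_of u *m invmx N) *m N) = row_of u - x *m N.
    by rewrite mulmxBl mulmxKV// opprB.
  by apply/seteqP; split=> [x [_] /=|x /=]; rewrite uK.
- rewrite (_ : [set _ | _] = set0) ?leb0//.
  by rewrite -subset0 => x [].
Qed.

Definition cons_row n (s : R) (y : 'rV[R]_n) : 'rV[R]_(1 + n) := row_mx s%:M y.

Lemma cons_row0 n s (y : 'rV[R]_n) : cons_row s y 0 0 = s.
Proof. by rewrite mxE; case: splitP => // l _; rewrite mxE !ord1 eqxx mulr1n. Qed.

Lemma cons_rowK n s (y : 'rV[R]_n) : rsubmx (cons_row s y) = y.
Proof. exact: row_mxKr. Qed.

Lemma cons_rowE n (x : 'rV[R]_(1 + n)) : x = cons_row (x 0 0) (rsubmx x).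
Proof.
rewrite -[LHS]hsubmxK; congr row_mx; apply/matrixP => i j; rewrite !ord1 !mxE eqxx mulr1n.
by congr (x _ _); exact/val_inj.
Qed.

Lemma row_of_cons n s (t : Rn n) :
  row_of (cons_pair (s, t)) = cons_row s (row_of t).
Proof.
apply/rowP => k; rewrite /cons_row !mxE; case: splitP => l kl.
  by rewrite !mxE !ord1 (_ : k = ord0) ?tnth0//; apply/val_inj; rewrite /= kl ord1.
by rewrite mxE (_ : k = lift ord0 l) ?tnthS//; apply/val_inj.
Qed.

Lemma leb_cons n (S : set 'rV[R]_(1 + n)) :
  (leb S = \int[lebesgue_measure]_s leb [set y | S (cons_row s y)])%E.
Proof.
rewrite /leb /= /lebesgue_cons /pushforward /product_measure1.
congr integral; apply/funext => s /=; rewrite /leb; congr (lebesgue_tuple _ _).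
by apply/funext => u; rewrite /xsection/= inE/= row_of_cons.
Qed.

Lemma mrow_section n (S : set 'rV[R]_(1 + n)) s : mrow S ->
  mrow [set y | S (cons_row s y)].
Proof.
move=> mS; rewrite /mrow.
rewrite (_ : _ @^-1` _ = (fun t => cons_pair (s, t)) @^-1` (@row_of R (1 + n) @^-1` S)).
  have mcons : measurable_fun setT (fun t : Rn n => cons_pair (s, t)).
    apply: (@measurable_cons _ _ (Rn n) (measurableTypeR R) (fun=> s) n id) => //.
  by rewrite -[X in measurable X]setTI; exact: mcons.
by apply/seteqP; split=> t /=; rewrite row_of_cons.
Qed.

Lemma leb_prod n (A : set (measurableTypeR R)) (S : set 'rV[R]_n) :
  measurable A -> mrow S ->
  (leb [set x : 'rV[R]_(1 + n) | A (x 0%R 0%R) /\ S (rsubmx x)]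
   = lebesgue_measure A * leb S)%E.
Proof.
move=> mA mS; rewrite leb_cons.
rewrite (eq_integral (fun s => (\1_A s)%:E * leb S)%E); last first.
  move=> s _; rewrite indicE; have [/set_mem As|nAs] := boolP (s \in A).
    rewrite mul1e; congr (leb _).
    by apply/seteqP; split=> y /=; rewrite cons_row0 cons_rowK => // -[].
  rewrite mul0e (_ : [set _ | _] = set0) ?leb0// -subset0 => y [/=].
  by rewrite cons_row0 => /mem_set; rewrite (negbTE nAs).
rewrite ge0_integralZr ?integral_indic ?setIT//; exact: measurableT_comp.
Qed.

End linear_measure.

(** * Compact and convex sets of row vectors *)

Section row_sets.
Context {R : realType}.

Lemma continuous_mx (T : topologicalType) m n (f : T -> 'M[R]_(m, n)) :
  (forall i j, continuous (fun t => f t i j)) -> continuous f.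
Proof.
move=> cf t A [P nP PA]; apply: (@filterS _ _ _ (fun s => forall ij, P ij.1 ij.2 (f s ij.1 ij.2))).
  by move=> s Ps; apply: PA => i j; exact: (Ps (i, j)).
by apply: filter_forall => -[i j] /=; exact: cf (nP i j).
Qed.

Lemma continuous_sum (T : topologicalType) (I : Type) (s : seq I) (P : pred I) (f : I -> T -> R) :
  (forall i, continuous (f i)) -> continuous (fun t => \sum_(i <- s | P i) f i t).
Proof.
move=> cf; elim: s => [|i s IH] t.
  by under eq_fun do rewrite big_nil; exact: cst_continuous.
under eq_fun do rewrite big_cons.
case: (P i); last exact: IH.
by apply: (@continuousD _ _ _ (f i)); [exact: cf|exact: IH].
Qed.

Lemma continuous_prod (T : topologicalType) (I : Type) (s : seq I) (P : pred I) (f : I -> T -> R) :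
  (forall i, continuous (f i)) -> continuous (fun t => \prod_(i <- s | P i) f i t).
Proof.
move=> cf; elim: s => [|i s IH] t.
  by under eq_fun do rewrite big_nil; exact: cst_continuous.
under eq_fun do rewrite big_cons.
case: (P i); last exact: IH.
by apply: (@continuousM _ _ (f i)); [exact: cf|exact: IH].
Qed.

Lemma continuous_mulmx (T : topologicalType) m n p (f : T -> 'M[R]_(m, n)) (g : T -> 'M[R]_(n, p)) :
  continuous f -> continuous g -> continuous (fun t => f t *m g t).
Proof.
move=> cf cg; apply: continuous_mx => i k.
under eq_fun do rewrite mxE.
apply: continuous_sum => j t.
apply: (@continuousM _ _ (fun t => f t i j) (fun t => g t j k)).
  exact: (continuous_comp (cf t) (@coord_continuous R m n i j (f t))).
exact: (continuous_comp (cg t) (@coord_continuous R n p j k (g t))).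
Qed.

Lemma continuous_mulmxr m n p (M : 'M[R]_(n, p)) : continuous (fun x : 'M[R]_(m, n) => x *m M).
Proof. by apply: continuous_mulmx => t; [exact: cvg_id|exact: cst_continuous]. Qed.

Lemma continuous_det (T : topologicalType) n (f : T -> 'M[R]_n) :
  continuous f -> continuous (fun t => \det (f t)).
Proof.
move=> cf; apply: continuous_sum => s t.
apply: (@continuousM _ _ (fun=> _) _); first exact: cst_continuous.
apply: continuous_prod => i {}t.
exact: (continuous_comp (cf t) (@coord_continuous R n n i _ (f t))).
Qed.

Definition linear_image m n (M : 'M[R]_(m, n)) (X : set 'rV[R]_m) : set 'rV[R]_n :=
  (fun x => x *m M) @` X.

Definition minkowski_sum n (A B : set 'rV[R]_n) : set 'rV[R]_n :=
  [set a + b | a in A & b in B].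

Lemma compact_linear_image m n (M : 'M[R]_(m, n)) X : compact X -> compact (linear_image M X).
Proof. by apply: continuous_compact; apply: continuous_subspaceT; exact: continuous_mulmxr. Qed.

Lemma compact_minkowski_sum n (A B : set 'rV[R]_n) :
  compact A -> compact B -> compact (minkowski_sum A B).
Proof.
move=> cA cB; rewrite (_ : minkowski_sum A B = (fun p => p.1 + p.2) @` (A `*` B)); last first.
  apply/seteqP; split=> [_ [a Aa [b Bb <-]]|_ [[a b] [/= Aa Bb] <-]]; first by exists (a, b).
  by exists a => //; exists b.
apply: continuous_compact; last exact: compact_setX.
apply: continuous_subspaceT => p.
by apply: (@continuousD _ _ _ fst snd); [exact: cvg_fst|exact: cvg_snd].
Qed.

Lemma compact_mrow n (X : set 'rV[R]_n) : compact X -> mrow X.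
Proof. by move=> cX; apply: mrow_closed; apply: compact_closed cX; exact: norm_hausdorff. Qed.

(** Convexity in terms of the row vector operations, see [convexE]. *)
Definition convex n (K : set 'rV[R]_n) : Prop := forall x y t, K x -> K y -> 0 <= t <= 1 ->
  K (t *: x + (1 - t) *: y).

Lemma convexE n (K : set 'rV[R]_n) : convex_set (K : set (convex_lmodType 'rV[R]_n)) <-> convex K.
Proof.
split=> [cK x y t Kx Ky /andP[t0 t1]|cK x y t].
  have := cK x y (Itv01 t0 t1); rewrite !inE; exact.
rewrite !inE => Kx Ky; apply: cK => //; apply/andP; split; [exact: ge0|exact: le1].
Qed.

Lemma convex_linear_image m n (M : 'M[R]_(m, n)) X : convex X -> convex (linear_image M X).
Proof.
move=> cX _ _ t [x Xx <-] [y Xy <-] t01; exists (t *: x + (1 - t) *: y); first exact: cX.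
by rewrite mulmxDl !scalemxAl.
Qed.

Lemma convex_minkowski_sum n (A B : set 'rV[R]_n) :
  convex A -> convex B -> convex (minkowski_sum A B).
Proof.
move=> cA cB _ _ t [a Aa [b Bb <-]] [a' Aa' [b' Bb' <-]] t01.
exists (t *: a + (1 - t) *: a'); first exact: cA.
exists (t *: b + (1 - t) *: b'); first exact: cB.
by rewrite !scalerDr addrACA.
Qed.

Lemma linear_image_sum m n (M : 'M[R]_(m, n)) A B :
  linear_image M (minkowski_sum A B) = minkowski_sum (linear_image M A) (linear_image M B).
Proof.
apply/seteqP; split=> [_ [_ [a Aa [b Bb <-]] <-]|_ [_ [a Aa <-] [_ [b Bb <-] <-]]].
  exists (a *m M); first by exists a.
  by exists (b *m M); [exists b|rewrite mulmxDl].
by exists (a + b); [exists a => //; exists b|rewrite mulmxDl].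
Qed.

Lemma linear_image_comp m n p (M : 'M[R]_(m, n)) (N : 'M[R]_(n, p)) X :
  linear_image N (linear_image M X) = linear_image (M *m N) X.
Proof.
rewrite /linear_image image_comp; congr (_ @` _); apply/funext => x /=.
by rewrite mulmxA.
Qed.

Definition cube n (c : R) : set 'rV[R]_n := [set x | forall k, `|x 0 k| <= c].
Arguments cube n c _ : clear implicits.

Lemma mrow_cube n c : mrow (cube n c).
Proof.
rewrite /mrow (_ : _ @^-1` _ = \bigcap_(k in [set: 'I_n]) (@row_of R n @^-1` [set x |
    `[- c, c]%classic (x 0 k)])).
  apply: fin_bigcap_measurable => // k _; apply: mrow_coord; exact: measurable_itv.
apply/seteqP; split=> t /= tc k; [move=> _|move: (tc k Logic.I)].
  by have := tc k; rewrite ler_norml /= in_itv/=.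
by rewrite ler_norml /= in_itv/=.
Qed.

Lemma leb_cube n c : 0 <= c -> leb (cube n c) = ((2 * c) ^+ n)%:E.
Proof.
move=> c0; elim: n => [|n IH].
  rewrite /leb (_ : _ @^-1` _ = setT) /=; first by rewrite diracT expr0.
  by apply/seteqP; split=> // t _ [].
rewrite (_ : cube n.+1 c = [set x : 'rV[R]_(1 + n) |
    `[- c, c]%classic (x 0%R 0%R) /\ cube n c (rsubmx x)]).
  rewrite (leb_prod (A := `[- c, c]%classic)); [|exact: measurable_itv|exact: mrow_cube].
  rewrite IH lebesgue_measure_itv/= lte_fin exprS EFinM; congr (_ * _)%E.
  case: ltP => cc; first by rewrite -EFinB; congr EFin; ring.
  by congr EFin; lra.
apply/seteqP; split=> x /= => [xc|[]].
  split; first by rewrite in_itv/= -ler_norml; exact: xc.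
  by move=> k; rewrite mxE; exact: xc.
rewrite in_itv/= -ler_norml => x0 xc k; rewrite -[k](splitK (m := 1)).
case: fintype.split => l /=; last by have := xc l; rewrite mxE.
suff -> : lshift n l = 0 :> 'I_n.+1 by [].
by apply/val_inj; rewrite /= (ord1 l).
Qed.

Lemma cubeE n c (x : 'rV[R]_n) : 0 <= c -> cube n c x <-> `|x| <= c.
Proof.
move=> c0; rewrite {1}/Num.norm/= mx_normrE; split=> [xc|].
  by apply: bigmax_le => // -[i k] _ /=; rewrite ord1.
by move=> /bigmax_leP[_ xc] k; exact: (xc (0, k)).
Qed.

Lemma entry_le_norm m n (M : 'M[R]_(m, n)) i j : `|M i j| <= `|M|.
Proof. by rewrite {2}/Num.norm/= mx_normrE (le_bigmax _ (fun ij => `|M ij.1 ij.2|) (i, j)). Qed.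

Lemma compact_cube n c : compact (cube n c).
Proof.
apply: bounded_closed_compact.
  exists (`|c|); split=> [|M cM x xc]; first exact: num_real.
  have M0 : 0 <= M by rewrite (le_trans _ (ltW cM)).
  apply/cubeE => // k; rewrite (le_trans (xc k))// (le_trans (ler_norm _))// ltW//.
rewrite (_ : cube n c = \bigcap_(k in [set: 'I_n]) ((fun x : 'rV[R]_n => `|x 0 k|) @^-1` [set z | z <= c])).
  apply: closed_bigI => k _; apply: preimage_closed; last exact: closed_le.
  move=> x _; apply: (continuous_comp (f := fun x : 'rV[R]_n => x 0 k)); last exact: norm_continuous.
  exact: coord_continuous.
by apply/seteqP; split=> x /= xc k; [move=> _; exact: xc|exact: (xc k Logic.I)].
Qed.

Lemma convex_cube n c : convex (cube n c).
Proof.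
move=> x y t xc yc /andP[t0 t1] k; rewrite !mxE.
rewrite (le_trans (ler_normD _ _))// !normrM (ger0_norm t0).
rewrite (ger0_norm (_ : 0 <= 1 - t)) ?subr_ge0//.
rewrite [leRHS](_ : c = t * c + (1 - t) * c); last by ring.
by rewrite lerD// ler_wpM2l// subr_ge0.
Qed.

Lemma compact_sub_cube n (X : set 'rV[R]_n) : compact X ->
  exists2 c, 0 < c & X `<=` cube n c.
Proof.
move=> /compact_bounded[M [_ XM]]; exists (`|M| + 1); first by rewrite ltr_wpDl.
move=> x Xx; apply/cubeE; first by rewrite addr_ge0.
by apply: (XM _ _ x Xx); rewrite (le_lt_trans (ler_norm _))// ltrDl.
Qed.

Lemma leb_fin n (X : set 'rV[R]_n) : compact X -> leb X \is a fin_num.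
Proof.
move=> cX; have [c c0 Xc] := compact_sub_cube cX.
rewrite ge0_fin_numE ?leb_ge0//.
apply: (le_lt_trans (le_leb (compact_mrow cX) (mrow_cube c) Xc)).
by rewrite leb_cube ?ltW// ltry.
Qed.

End row_sets.
Arguments cube {R} n c _.

(** * Linear maps multiply volumes by a constant *)

Section dilation.
Context {R : realType}.

Lemma linear_image_unit n (M : 'M[R]_n) X : M \in unitmx ->
  linear_image M X = [set y | X (y *m invmx M)].
Proof.
move=> uM; apply/seteqP; split=> [_ [x Xx <-]|y /= Xy]; first by rewrite /= mulmxK.
by exists (y *m invmx M) => //; rewrite mulmxKV.
Qed.

(** With a centrally symmetric cube [Q], the exchange lemma reads
    [leb (X M) * leb Q = leb X * leb (Q M)], so the constant is [leb (Q M) / leb Q]. It is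
    positive because [Q] itself is the image of a compact set. *)
Lemma dilation_unit n (M : 'M[R]_n) : M \in unitmx ->
  exists2 c, 0 < c & forall X, compact X -> leb (linear_image M X) = (c%:E * leb X)%E.
Proof.
move=> uM; pose Q : set 'rV[R]_n := cube n 1.
have Q2 : leb Q = (2 ^+ n)%:E by rewrite leb_cube// mulr1.
have Q20 : 0 < 2 ^+ n :> R by rewrite exprn_gt0.
have QN x : Q (- x) = Q x.
  by apply/propext; split=> Qx k; have := Qx k; rewrite mxE normrN.
have aE X : compact X -> (leb (linear_image M X) * leb Q = leb X * leb (linear_image M Q))%E.
  move=> cX; rewrite !linear_image_unit//.
  rewrite leb_linear_exchange ?unitmx_inv//; [|exact: compact_mrow|exact: mrow_cube].
  by congr (_ * leb _)%E; apply/funext => x /=; rewrite QN.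
have /fineK af := leb_fin (compact_linear_image (M := M) (@compact_cube R n 1)).
exists (fine (leb (linear_image M Q)) / 2 ^+ n).
  rewrite divr_gt0// lt_neqAle fine_ge0 ?leb_ge0// andbT eq_sym; apply/eqP => a0.
  have := aE (linear_image (invmx M) Q) (compact_linear_image (@compact_cube R n 1)).
  rewrite linear_image_comp mulVmx// -af a0 mule0 (_ : linear_image 1%:M Q = Q).
    rewrite Q2 -EFinM => -[] /eqP; rewrite mulf_eq0 orbb => /eqP Q0.
    by rewrite Q0 ltxx in Q20.
  by apply/seteqP; split=> [_ [x Qx <-]|x Qx]; [|exists x => //]; rewrite mulmx1.
move=> X cX; have := aE X cX; rewrite -af Q2.
have /fineK <- := leb_fin cX; have /fineK <- := leb_fin (compact_linear_image (M := M) cX).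
rewrite -!EFinM => -[] xE; congr EFin; apply: (mulIf (lt0r_neq0 Q20)).
by rewrite xE mulrAC divfK ?gt_eqF// mulrC.
Qed.

(** A column operation turns the hyperplane into a coordinate hyperplane [A], and the
    exchange lemma multiplies [leb A = 0] by a finite volume. *)
Lemma leb_hyperplane n (w : 'cV[R]_n) : w != 0 -> leb [set x : 'rV_n | x *m w = 0] = 0%E.
Proof.
case: n w => [|n] w w0; first by rewrite [w]flatmx0 eqxx in w0.
have rw : \rank w = 1%N.
  by apply/eqP; rewrite eqn_leq rank_leq_col lt0n mxrank_eq0.
pose A : set 'rV[R]_(1 + n) := [set x : 'rV[R]_(1 + n) | [set 0] (x 0%R 0%R) /\ setT (rsubmx x)].
have mA0 : mrow (setT : set 'rV[R]_n) by rewrite /mrow preimage_setT.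
have A0 : leb A = 0%E.
  by rewrite (leb_prod (A := [set 0])) ?lebesgue_measure_set1 ?mul0e//.
have mA : mrow A.
  rewrite (_ : A = [set x : 'rV[R]_(1 + n) | [set 0] (x 0%R 0%R)]); first exact: mrow_coord.
  by apply/seteqP; split=> x /= => [[]|].
have pidE (y : 'rV[R]_n.+1) : (y *m pid_mx 1 : 'M[R]_1) 0 0 = y 0 0.
  rewrite mxE big_ord_recl mxE/= mulr1 big1 ?addr0// => k _.
  by rewrite mxE/= mulr0.
have -> : [set x : 'rV_n.+1 | x *m w = 0] = [set x | A (x *m col_ebase w)].
  rewrite -[in X in X = _](mulmx_ebase w) rw; apply/seteqP; split=> x /=.
    rewrite !mulmxA => /(congr1 (mulmx ^~ (invmx (row_ebase w)))).
    rewrite mulmxK ?row_ebase_unit// mul0mx => /matrixP/(_ 0 0).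
    by rewrite pidE [RHS]mxE => x0; split.
  case=> x0 _; rewrite !mulmxA (_ : _ *m pid_mx 1 = 0) ?mul0mx//.
  by apply/matrixP => i j; rewrite !ord1 pidE x0 mxE.
have := leb_linear_exchange (col_ebase_unit w) mA (@mrow_cube R n.+1 1).
rewrite A0 mul0e leb_cube// mulr1 => /eqP; rewrite mule_eq0 => /orP[/eqP//|].
by rewrite eqe gt_eqF ?exprn_gt0.
Qed.

Lemma dilation_singular n (M : 'M[R]_n) X : M \notin unitmx -> compact X ->
  leb (linear_image M X) = 0%E.
Proof.
rewrite -row_full_unit => sM cX.
have [i [j Mij]] : exists i j, cokermx M i j != 0.
  apply: contra_notP (negP sM) => H; rewrite -cokermx_eq0; apply/eqP/matrixP => i j.
  by apply: contra_notP H => /eqP; rewrite [X in _ != X]mxE => Mij; exists i, j.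
have w0 : col j (cokermx M) != 0.
  by apply: contra Mij => /eqP/matrixP/(_ i 0); rewrite !mxE => ->.
apply/eqP; rewrite eq_le leb_ge0 andbT -(leb_hyperplane w0); apply: le_leb.
- by apply: compact_mrow; exact: compact_linear_image.
- have := mrow_linear (col j (cokermx M)) (@mrow_coord R 1 0 [set 0] (measurable_set1 _)).
  congr (mrow _); apply/seteqP; split=> x /=.
    by move=> x0; apply/matrixP => k l; rewrite !ord1 x0 mxE.
  by move=> ->; rewrite mxE.
- by move=> _ [x Xx <-] /=; rewrite colE mulmxA -(mulmxA x) mulmx_coker mulmx0 mul0mx.
Qed.

Lemma dilation n (M : 'M[R]_n) : exists c,
  [/\ 0 <= c, M \in unitmx -> 0 < c
    & forall X, compact X -> leb (linear_image M X) = (c%:E * leb X)%E].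
Proof.
have [/[dup] uM /dilation_unit[c c0 cX]|sM] := boolP (M \in unitmx).
  by exists c; split=> //; exact: ltW.
by exists 0; split=> [//||X cX]; rewrite ?(negbTE sM)// mul0e dilation_singular.
Qed.

End dilation.

(** * Adding a short segment to a convex set *)

Section segment.
Context {R : realType}.

Lemma mrow_setD n (S T : set 'rV[R]_n) : mrow S -> mrow T -> mrow (S `\` T).
Proof. by move=> mS mT; exact: (measurableD mS mT). Qed.

Lemma mrow_setU n (S T : set 'rV[R]_n) : mrow S -> mrow T -> mrow (S `|` T).
Proof. by move=> mS mT; exact: (measurableU _ _ mS mT). Qed.

Lemma leb_setU n (S T : set 'rV[R]_n) : mrow S -> mrow T -> S `&` T = set0 ->
  leb (S `|` T) = (leb S + leb T)%E.
Proof.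
by move=> mS mT ST; rewrite /leb preimage_setU measureU// -preimage_setI ST preimage_set0.
Qed.

Definition segment n (a b : R) (v : 'rV[R]_n) : set 'rV[R]_n :=
  [set t *: v | t in [set t | a <= t <= b]].

Lemma compact_segment n a b (v : 'rV[R]_n) : compact (segment a b v).
Proof.
apply: continuous_compact; last first.
  rewrite (_ : [set t | _] = `[a, b]%classic); first exact: segment_compact.
  by apply/seteqP; split=> t /=; rewrite in_itv.
by apply: continuous_subspaceT => t; exact: scalel_continuous.
Qed.

Lemma convex_segment n a b (v : 'rV[R]_n) : convex (segment a b v).
Proof.
move=> _ _ t [x /andP[ax xb] <-] [y /andP[ay yb] <-] /andP[t0 t1].
exists (t * x + (1 - t) * y); last by rewrite !scalerA -scalerDl.
have {}t1 : 0 <= 1 - t by rewrite subr_ge0.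
apply/andP; split.
  rewrite [leLHS](_ : a = t * a + (1 - t) * a); last by ring.
  by rewrite lerD// ler_wpM2l.
rewrite [leRHS](_ : b = t * b + (1 - t) * b); last by ring.
by rewrite lerD// ler_wpM2l.
Qed.

Lemma leb_translate n (A : set 'rV[R]_n) v : mrow A ->
  leb ((fun x => x + v) @` A) = leb A.
Proof.
move=> mA; rewrite -[RHS](leb_add (- v) mA); congr leb.
by apply/seteqP; split=> [_ [x Ax <-]|x /= Ax]; [rewrite /= addrK|exists (x - v) => //; rewrite subrK].
Qed.

Lemma mrow_translate n (A : set 'rV[R]_n) v : mrow A -> mrow ((fun x => x + v) @` A).
Proof.
move=> mA; have := mrow_add (- v) mA; congr (mrow _).
by apply/seteqP; split=> [x /= Ax|_ [x Ax <-]]; [exists (x - v) => //; rewrite subrK|rewrite /= addrK].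
Qed.

(** The translates of [D = (A + [0, w]) \ A] by the multiples [0, w, ..., (N - 1) w] are
    disjoint and lie in [A + [0, N w]], so [D] has at most the [N]-th part of its volume.
    They are disjoint by convexity: once a ray in direction [w] has left [A], it does
    not come back. *)
Lemma leb_add_segment n (A : set 'rV[R]_n) (w : 'rV[R]_n) N : compact A -> convex A ->
  (0 < N)%N ->
  (leb (minkowski_sum A (segment 0 1 w)) <=
    leb A + N%:R^-1%:E * leb (minkowski_sum A (segment 0 N%:R w)))%E.
Proof.
move=> cA xA N0; pose S k := minkowski_sum A (segment 0 k%:R w).
have cS k : compact (S k) by apply: compact_minkowski_sum => //; exact: compact_segment.
have mS k : mrow (S k) by apply: compact_mrow.
have AS : A `<=` S 0%N.
  move=> a Aa; exists a => //; exists 0; last by rewrite addr0.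
  by exists 0; rewrite /= ?lexx ?scale0r.
have S0 : S 0%N = A.
  apply/seteqP; split=> // _ [a Aa [_ [t /andP[t0 t1] <-] <-]].
  by rewrite (_ : t = 0) ?scale0r ?addr0//; apply/eqP; rewrite eq_le t0 t1.
pose D := S 1%N `\` A; have mD : mrow D by apply: mrow_setD => //; exact: compact_mrow.
have Dfin : leb D \is a fin_num.
  rewrite ge0_fin_numE ?leb_ge0//; apply: (le_lt_trans (le_leb mD (mS 1%N) _)) => [x []//|].
  by rewrite -ge0_fin_numE ?leb_ge0// leb_fin.
have SSk k : (leb (S k) + leb D <= leb (S k.+1))%E.
  rewrite -(leb_translate (k%:R *: w) mD) -leb_setU//; [|exact: mrow_translate|].
    apply: le_leb => //; first by apply: mrow_setU => //; exact: mrow_translate.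
    move=> x [|[y [[a Aa [_ [t /andP[t0 t1] <-] <-]] _] <-]].
      move=> [a Aa [_ [t /andP[t0 t1] <-] <-]]; exists a => //; exists (t *: w) => //.
      by exists t => //=; rewrite t0 (le_trans t1)// ler_nat.
    exists a => //; exists ((t + k%:R) *: w); last by rewrite scalerDl addrA.
    by exists (t + k%:R) => //=; rewrite addr_ge0//= -natr1 addrC lerD2l.
  rewrite -subset0 => _ [[a Aa [_ [t /andP[t0 tk] <-] <-]] [y [[a' Aa' [_ [s /andP[s0 s1] <-] <-]] nA] e]].
  (* The point [a' + s *: w] is outside [A], but lies between [a'] and [a]. *)
  apply: nA; have [p0|p0] := eqVneq (s + (k%:R - t)) 0.
    suff -> : s *: w = 0 by rewrite addr0.
    suff -> : s = 0 by rewrite scale0r.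
    by apply/eqP; rewrite eq_le s0 andbT; move: p0 t0 tk; lra.
  have pp : 0 < s + (k%:R - t) by rewrite lt_neqAle eq_sym p0 addr_ge0// subr_ge0.
  pose r := s / (s + (k%:R - t)).
  have aE : a = a' + (s + k%:R - t) *: w.
    apply: (addIr (t *: w)); rewrite -e -!addrA -!scalerDl; congr (a' + _ *: w); ring.
  have -> : a' + s *: w = r *: a + (1 - r) *: a'.
    rewrite aE scalerDr scalerA (_ : r * _ = s); last by rewrite /r -addrA divfK.
    by rewrite addrAC -scalerDl (_ : r + (1 - r) = 1) ?scale1r//; ring.
  apply: xA => //; apply/andP; split; first by rewrite divr_ge0// ltW.
  by rewrite ler_pdivrMr// mul1r lerDl subr_ge0.
have SN k : (k%:R%:E * leb D <= leb (S k))%E.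
  elim: k => [|k IH]; first by rewrite mul0e leb_ge0.
  apply: le_trans (SSk k); rewrite -natr1 EFinD ge0_muleDl ?lee_fin//.
  by rewrite mul1e leeD2r.
rewrite -/(S N) -/(S 1%N).
apply: (@le_trans _ _ (leb A + leb D)%E).
  rewrite -leb_setU//; last 2 first.
  - exact: compact_mrow.
  - by rewrite setDIK.
  apply: le_leb => //; first by apply: mrow_setU => //; exact: compact_mrow.
  by move=> x Sx; have [Ax|nAx] := pselect (A x); [left|right].
apply: leeD => //; have := SN N; have /fineK <- := leb_fin (cS N).
rewrite -(fineK Dfin) -!EFinM !lee_fin -ler_pdivlMl ?ltr0n//.
Qed.

End segment.

(** * Adding a small zonotope to a convex set *)

Section zonotope.
Context {R : realType}.

Fixpoint zonotope n (c : R) (vs : seq 'rV[R]_n) : set 'rV[R]_n :=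
  if vs is v :: vs' then minkowski_sum (zonotope c vs') (segment (- c) c v) else [set 0].

Lemma compact_zonotope n c (vs : seq 'rV[R]_n) : compact (zonotope c vs).
Proof.
elim: vs => [|v vs IH] /=; first exact: compact_set1.
by apply: compact_minkowski_sum => //; exact: compact_segment.
Qed.

Lemma convex_zonotope n c (vs : seq 'rV[R]_n) : convex (zonotope c vs).
Proof.
elim: vs => [|v vs IH] /=; last by apply: convex_minkowski_sum => //; exact: convex_segment.
by move=> x y t -> -> _; rewrite /= !scaler0 addr0.
Qed.

Lemma minkowski_sumS n (A B C D : set 'rV[R]_n) : A `<=` B -> C `<=` D ->
  minkowski_sum A C `<=` minkowski_sum B D.
Proof. by move=> AB CD _ [a Aa [c Cc <-]]; exists a; [exact: AB|exists c => //; exact: CD]. Qed.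

Lemma minkowski_sumA n (A B C : set 'rV[R]_n) :
  minkowski_sum A (minkowski_sum B C) = minkowski_sum (minkowski_sum A B) C.
Proof.
apply/seteqP; split=> [_ [a Aa [_ [b Bb [c Cc <-]] <-]]|_ [_ [a Aa [b Bb <-]] [c Cc <-]]].
  by exists (a + b); [exists a => //; exists b|exists c => //; rewrite addrA].
by exists a => //; exists (b + c); [exists b => //; exists c|rewrite addrA].
Qed.

Lemma minkowski_sum0 n (A : set 'rV[R]_n) : minkowski_sum A [set 0] = A.
Proof.
apply/seteqP; split=> [_ [a Aa [_ -> <-]]|a Aa]; first by rewrite addr0.
by exists a => //; exists 0 => //; rewrite addr0.
Qed.

Lemma zonotope_le n c c' (vs : seq 'rV[R]_n) : c <= c' -> zonotope c vs `<=` zonotope c' vs.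
Proof.
move=> cc'; elim: vs => //= v vs IH; apply: minkowski_sumS => // _ [t /andP[t0 t1] <-].
by exists t => //=; apply/andP; split; lra.
Qed.

Lemma zonotope_combination n (I : Type) (s : seq I) (x : I -> R) (f : I -> 'rV[R]_n) c :
  (forall i, `|x i| <= c) -> zonotope c [seq f i | i <- s] (\sum_(i <- s) x i *: f i).
Proof.
move=> xc; elim: s => [|i s IH] /=; first by rewrite big_nil.
rewrite big_cons addrC; exists (\sum_(j <- s) x j *: f j) => //.
by exists (x i *: f i) => //; exists (x i) => //=; rewrite -ler_norml.
Qed.

Lemma zonotope0 n c (vs : seq 'rV[R]_n) : 0 <= c -> zonotope c vs 0.
Proof.
move=> c0; have := @zonotope_combination n _ vs (fun=> 0) id c.
rewrite map_id big1 => [|v _]; last by rewrite scale0r.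
by apply=> _; rewrite normr0.
Qed.

Lemma linear_image_segment m n (M : 'M[R]_(m, n)) a b v :
  linear_image M (segment a b v) = segment a b (v *m M).
Proof.
apply/seteqP; split=> [_ [_ [t tab <-] <-]|_ [t tab <-]].
  by exists t => //; rewrite scalemxAl.
by exists (t *: v); [exists t|rewrite scalemxAl].
Qed.

Lemma linear_image_zonotope m n (M : 'M[R]_(m, n)) c vs :
  linear_image M (zonotope c vs) = zonotope c [seq v *m M | v <- vs].
Proof.
elim: vs => [|v vs IH] /=; last by rewrite linear_image_sum IH linear_image_segment.
by apply/seteqP; split=> [_ [_ -> <-]|_ ->]; rewrite /= ?mul0mx//; exists 0 => //; rewrite mul0mx.
Qed.

Lemma zonotope_invariant n (M : 'M[R]_n) c vs :
  {in vs, forall v, v *m M = v \/ v *m M = - v} -> linear_image M (zonotope c vs) = zonotope c vs.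
Proof.
rewrite linear_image_zonotope; elim: vs => //= v vs IH vM.
rewrite IH => [|u us]; last by apply: vM; rewrite inE us orbT.
congr minkowski_sum; have [->//|->] := vM v (mem_head _ _).
by apply/seteqP; split=> _ [t /andP[t0 t1] <-]; exists (- t);
  rewrite ?scalerN ?scaleNr ?opprK//=; apply/andP; split; lra.
Qed.

Lemma minkowski_sum_segment n (A : set 'rV[R]_n) v c d k : 0 < d -> k * d = 2 * c ->
  minkowski_sum A (segment (- c) c v) =
  (fun x => x + - c *: v) @` minkowski_sum A (segment 0 k (d *: v)).
Proof.
move=> d0 kd; apply/seteqP; split=> [_ [a Aa [_ [t /andP[t0 t1] <-] <-]]|].
  exists (a + (t + c) *: v); last by rewrite -addrA -scalerDl addrK.
  exists a => //; exists ((t + c) *: v) => //; exists ((t + c) / d).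
    by rewrite /= ler_pdivlMr// ler_pdivrMr// kd mul0r; apply/andP; split; lra.
  by rewrite scalerA divfK ?gt_eqF.
move=> _ [_ [a Aa [_ [t /andP[t0 t1] <-] <-]] <-]; exists a => //.
exists ((t * d - c) *: v); last by rewrite -addrA scalerA -scalerDl.
exists (t * d - c) => //=; have td0 : 0 <= t * d by rewrite mulr_ge0// ltW.
have td1 : t * d <= k * d by rewrite ler_pM2r.
by apply/andP; split; lra.
Qed.

Lemma leb_add_small_segment n (A : set 'rV[R]_n) v N : compact A -> convex A -> (0 < N)%N ->
  (leb (minkowski_sum A (segment (- N%:R^-1) N%:R^-1 v)) <=
    leb A + N%:R^-1%:E * leb (minkowski_sum A (segment (- 1) 1 v)))%E.
Proof.
move=> cA xA N0; have NR0 : 0 < N%:R :> R by rewrite ltr0n.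
have d0 : 0 < 2 * N%:R^-1 :> R by rewrite mulr_gt0// invr_gt0.
have mS k w : mrow (minkowski_sum A (segment 0 k w)).
  by apply: compact_mrow; apply: compact_minkowski_sum => //; exact: compact_segment.
rewrite (minkowski_sum_segment _ _ d0 (mul1r _)) leb_translate//.
rewrite (minkowski_sum_segment (c := 1) (k := N%:R) _ _ d0); last by rewrite mulrCA divff ?gt_eqF.
rewrite leb_translate//; exact: leb_add_segment.
Qed.

(** The error term is the volume of a set that does not depend on [N]; this makes it
    uniformly bounded over all projections of a given compact set. *)
Lemma leb_add_zonotope n (A : set 'rV[R]_n) vs N : compact A -> convex A -> (0 < N)%N ->
  (leb (minkowski_sum A (zonotope N%:R^-1 vs)) <=
    leb A + ((size vs)%:R / N%:R)%:E * leb (minkowski_sum A (zonotope 1 vs)))%E.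
Proof.
move=> cA xA N0; have NR0 : 0 < N%:R :> R by rewrite ltr0n.
have N1 : N%:R^-1 <= 1 :> R by rewrite invf_le1// ler1n.
have cZ c us : compact (minkowski_sum A (zonotope c us)).
  by apply: compact_minkowski_sum => //; exact: compact_zonotope.
elim: vs => [|v vs IH] /=; first by rewrite !minkowski_sum0 mul0r mul0e adde0.
rewrite !minkowski_sumA; set Z := minkowski_sum A (zonotope N%:R^-1 vs).
set Z1 := minkowski_sum A (zonotope 1 vs).
have ZZ1 : Z `<=` Z1 by apply: minkowski_sumS => //; exact: zonotope_le.
apply: le_trans (leb_add_small_segment v (cZ _ _) _ N0) _.
  by apply: convex_minkowski_sum => //; exact: convex_zonotope.
rewrite -natr1 mulrDl div1r EFinD ge0_muleDl ?lee_fin ?divr_ge0 ?invr_ge0// addeA.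
have cS (Y : set 'rV[R]_n) : compact Y -> compact (minkowski_sum Y (segment (- 1) 1 v)).
  by move=> cY; apply: compact_minkowski_sum => //; exact: compact_segment.
apply: leeD; last first.
  apply: lee_wpmul2l; first by rewrite lee_fin invr_ge0.
  by apply: le_leb; [apply: compact_mrow; exact/cS/cZ..|exact: minkowski_sumS].
apply: (le_trans IH); apply: leeD => //; apply: lee_wpmul2l; first by rewrite lee_fin divr_ge0.
apply: le_leb; [apply: compact_mrow; exact: cZ|apply: compact_mrow; exact/cS/cZ|].
move=> z Zz; exists z => //; exists 0; last by rewrite addr0.
by exists 0; rewrite /= ?scale0r// lerN10 ler01.
Qed.

End zonotope.

(** * Coordinates of orthogonal projections *)

Section projection.
Context {R : realType} {n : nat}.
Implicit Types (E H : {vspace 'rV[R]_n}) (x y z : 'rV[R]_n).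

Lemma onbasis_orthonormal E : onbasis E *m (onbasis E)^T = 1%:M.
Proof. by have [] := onbasisP E. Qed.

Lemma orthonormal_generates E m (B : 'M[R]_(m, n)) : m = \dim E -> orthonormal_in E B ->
  forall z, z \in E -> z *m B^T *m B = z.
Proof.
move=> mE [BB BE] z; pose X := [tuple row i B | i < m].
have sumX k : \sum_(i < m) k i *: X`_i = \row_i k i *m B.
  by rewrite mulmx_sum_row; apply: eq_bigr => i _; rewrite mxE -tnth_nth tnth_mktuple.
have fX : free X.
  apply/freeP => k; rewrite sumX => kB i.
  have : (\row_i k i) *m B *m B^T = 0 by rewrite kB mul0mx.
  by rewrite -mulmxA BB mulmx1 => /rowP/(_ i); rewrite !mxE.
have XE : <<X>>%VS = E.
  have dX : \dim <<X>> = \dim E by rewrite (eqP fX) size_tuple.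
  apply/eqP; rewrite eqEdim dX leqnn andbT.
  by apply/span_subvP => _ /mapP[i _ ->].
by rewrite -{1}XE => /coord_span ->; rewrite sumX -(mulmxA _ B) BB mulmx1.
Qed.

Lemma onbasis_generates E z : z \in E -> z *m (onbasis E)^T *m onbasis E = z.
Proof. exact/orthonormal_generates/onbasisP. Qed.

Lemma oproj_unique E x y : y \in E -> (forall z, z \in E -> dot (x - y) z = 0) ->
  oproj E x = y.
Proof.
move=> yE yO; have [oE oO] := oprojP E x; apply/subr0_eq/dot_eq0.
have dE : oproj E x - y \in E by rewrite memvB.
have -> : dot (oproj E x - y) (oproj E x - y) =
    dot (x - y) (oproj E x - y) - dot (x - oproj E x) (oproj E x - y).
  by rewrite /dot -sumrB; apply: eq_bigr => k _; rewrite !mxE; ring.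
by rewrite yO// oO// subrr.
Qed.

Lemma oprojE E x : oproj E x = x *m ((onbasis E)^T *m onbasis E).
Proof.
have [BB BE] := onbasisP E; apply: oproj_unique => [|z zE].
  by rewrite mulmxA; exact: mulmx_memv.
have xyB : (x - x *m ((onbasis E)^T *m onbasis E)) *m (onbasis E)^T = 0.
  by rewrite mulmxBl mulmxA -(mulmxA _ _ (onbasis E)^T) BB mulmx1 subrr.
set P := _ *m onbasis E in xyB *.
by rewrite -(onbasis_generates zE) dotE trmx_mul mulmxA xyB mul0mx mxE.
Qed.

Lemma oproj_mxE E : oproj_mx E = (onbasis E)^T *m onbasis E.
Proof.
by apply/matrixP => i j; rewrite mxE oprojE -rowE mxE.
Qed.

Lemma Vol_oproj E K : Vol E (oproj E @` K) = leb (linear_image (onbasis E)^T K).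
Proof.
rewrite /Vol /leb; congr (lebesgue_tuple _ _); apply/seteqP; split=> t /=.
  move=> [x Kx]; rewrite oprojE mulmxA => /(congr1 (mulmx ^~ (onbasis E)^T)).
  rewrite -!(mulmxA _ (onbasis E)) onbasis_orthonormal !mulmx1 => xt.
  by exists x => //; rewrite xt.
by move=> [x Kx xt]; exists x => //; rewrite oprojE mulmxA xt.
Qed.

Lemma onbasis_entry E i k : `|onbasis E i k| <= 1.
Proof.
have /matrixP/(_ i i) := onbasis_orthonormal E; rewrite !mxE eqxx mulr1n => b1.
rewrite -(@ler_pXn2r _ 2)// ?nnegrE// expr1n real_normK ?num_real// -b1.
rewrite (bigD1 k)//= mxE expr2 lerDl sumr_ge0// => l _.
by rewrite mxE -expr2 sqr_ge0.
Qed.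

Lemma oproj_mx_rotate (g : 'M[R]_n) E : g *m g^T = 1%:M ->
  oproj_mx (rotate g E) = g^T *m oproj_mx E *m g.
Proof.
move=> gg; have gg' : g^T *m g = 1%:M by apply: mulmx1C.
apply/row_matrixP => i; rewrite !rowE.
have -> : delta_mx 0 i *m oproj_mx (rotate g E) = oproj (rotate g E) (delta_mx 0 i).
  by rewrite oproj_mxE oprojE.
apply: oproj_unique => [|z].
  rewrite mulmxA; set y := _ *m (_ *m oproj_mx E).
  rewrite (_ : y *m g = linfun (mulmxr g) y); last by rewrite lfunE.
  rewrite memv_img// /y oproj_mxE !mulmxA.
  by apply: mulmx_memv; case: (onbasisP E).
move=> /memv_imgP[y yE ->]; rewrite lfunE/=; set d := delta_mx 0 i.
have dg : (d - d *m (g^T *m oproj_mx E *m g)) *m g^T = d *m g^T - oproj E (d *m g^T).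
  by rewrite mulmxBl oprojE -oproj_mxE -!mulmxA gg mulmx1.
by rewrite dotE trmx_mul (mulmxA (d - _)) dg -dotE; have [_ ->] := oprojP E (d *m g^T).
Qed.

Lemma dim_rotate (g : 'M[R]_n) E : g *m g^T = 1%:M -> \dim (rotate g E) = \dim E.
Proof.
move=> gg; apply: limg_dim_eq; apply/eqP; rewrite -subv0; apply/subvP => x.
rewrite memv_cap memv_ker lfunE/= memv0 => /andP[_ /eqP xg].
by rewrite -[x]mulmx1 -gg mulmxA xg mul0mx.
Qed.

End projection.

(** * Integrals of arbitrary nonnegative functions *)

(** An intrinsic volume integrates the volume of the projection to [E], whose dependence
    on [E] is not analysed further. For nonnegative [f], measurable or not,
    [\int[mu]_x f x] is the supremum of the integrals of the simple functions below [f].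
    As a functional of [f] it is monotone, homogeneous and subadditive with respect to
    constants, which is enough to compare intrinsic volumes. *)

Section lower_integral.
Local Open Scope ereal_scope.
Context d (T : measurableType d) (R : realType) (mu : {measure set T -> \bar R}).
Implicit Types (f g : T -> \bar R) (D : set T).

Import HBNNSimple.

Lemma le_lower_integral D f g : (forall x, D x -> 0 <= f x) ->
  (forall x, D x -> f x <= g x) -> \int[mu]_(x in D) f x <= \int[mu]_(x in D) g x.
Proof.
move=> f0 fg; rewrite !ge0_integralE//; last by move=> x Dx; exact: le_trans (f0 x Dx) (fg x Dx).
apply: ereal_sup_le => _ [h /= hf <-].
exists h => //= x; apply: (le_trans (hf x)); rewrite /patch; case: ifPn => //.
by rewrite inE; exact: fg.
Qed.

Lemma lower_integral_le D f c : (forall x, D x -> 0 <= f x) ->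
  (forall h : {nnsfun T >-> R}, (forall x, (h x)%:E <= (f \_ D) x) -> \int[mu]_x (h x)%:E <= c) ->
  \int[mu]_(x in D) f x <= c.
Proof.
move=> f0 fc; rewrite ge0_integralE//; apply: ge_ereal_sup => _ [h /= hf <-].
by rewrite -integralT_nnsfun; exact: fc.
Qed.

Lemma lower_integral_restrict D f g : (forall x, 0 <= g x) ->
  (forall x, g x <= (f \_ D) x) -> \int[mu]_x g x <= \int[mu]_(x in D) f x.
Proof. by move=> g0 gf; rewrite [leRHS]integral_mkcond; exact: le_lower_integral. Qed.

Lemma lower_integralZ_le D f k : (0 < k)%R -> (forall x, D x -> 0 <= f x) ->
  \int[mu]_(x in D) (k%:E * f x) <= k%:E * \int[mu]_(x in D) f x.
Proof.
move=> k0 f0; apply: lower_integral_le => [x Dx|h hf].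
  by rewrite mule_ge0 ?f0// lee_fin ltW.
rewrite [leLHS](_ : _ = k%:E * \int[mu]_x (k^-1%:E * (h x)%:E)).
  apply: lee_wpmul2l; first by rewrite lee_fin ltW.
  apply: lower_integral_restrict => x; first by apply: mule_ge0; rewrite lee_fin// invr_ge0 ltW.
  rewrite muleC lee_pdivrMr// muleC; apply: (le_trans (hf x)).
  by rewrite /patch; case: ifP; rewrite ?mule0.
rewrite ge0_integralZl_EFin//; last 3 first.
- by move=> x _; rewrite lee_fin.
- exact/measurable_EFinP.
- by rewrite invr_ge0 ltW.
by rewrite muleA -EFinM divff ?gt_eqF// mul1e.
Qed.

Lemma lower_integralZ D f k : (0 <= k)%R -> (forall x, D x -> 0 <= f x) ->
  \int[mu]_(x in D) (k%:E * f x) = k%:E * \int[mu]_(x in D) f x.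
Proof.
rewrite le_eqVlt => /predU1P[<- f0|k0 f0].
  by rewrite mul0e integral0_eq// => x _; rewrite mul0e.
apply/eqP; rewrite eq_le lower_integralZ_le//=.
rewrite -lee_pdivlMl//; apply: le_trans (lower_integralZ_le _ _).
- rewrite le_eqVlt; apply/orP; left; apply/eqP; apply: eq_integral => x _.
  by rewrite muleA -EFinM mulVf ?gt_eqF// mul1e.
- by rewrite invr_gt0.
- by move=> x Dx; rewrite mule_ge0 ?f0// lee_fin ltW.
Qed.

(** If [h] is a simple function below [f], then the positive part of [h - c] is below
    [g]. *)
Lemma lower_integral_le_add D f g c : mu setT <= 1 -> (0 <= c)%R ->
  (forall x, D x -> 0 <= f x) -> (forall x, D x -> 0 <= g x) ->
  (forall x, D x -> f x <= g x + c%:E) ->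
  \int[mu]_(x in D) f x <= \int[mu]_(x in D) g x + c%:E.
Proof.
move=> mu1 c0 f0 g0 fg; apply: lower_integral_le => // h hf.
pose h' x := Num.max (h x - c)%R 0%R.
have mh' : measurable_fun setT (EFin \o h').
  by apply/measurable_EFinP; apply: measurable_maxr => //; exact: measurable_funB.
have h'0 x : 0 <= (h' x)%:E by rewrite lee_fin le_max lexx orbT.
apply: (@le_trans _ _ (\int[mu]_x ((h' x)%:E + c%:E))).
  apply: le_lower_integral => x _; first by rewrite lee_fin.
  by rewrite -EFinD lee_fin -lerBlDr le_max lexx.
rewrite ge0_integralD//.
apply: leeD; last first.
  rewrite integral_cst// -[leRHS]mule1; exact: lee_wpmul2l.
apply: lower_integral_restrict => // x; have := hf x; rewrite /patch; case: ifPn => [|_].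
  rewrite inE => Dx hfx; have := le_trans hfx (fg x Dx); have := g0 x Dx.
  case: (g x) => [r|_ _|//]; last exact: leey.
  by rewrite -EFinD !lee_fin => r0 hr; rewrite ge_max r0 andbT lerBlDr.
by rewrite !lee_fin => hx; rewrite ge_max lexx andbT; lra.
Qed.

Lemma lower_integral_ge D f S e : measurable S -> S `<=` D -> (0 <= e)%R ->
  (forall x, D x -> 0 <= f x) -> (forall x, S x -> e%:E <= f x) ->
  e%:E * mu S <= \int[mu]_(x in D) f x.
Proof.
move=> mS SD e0 f0 ef.
rewrite (_ : mu S = \int[mu]_x (\1_S x)%:E); last by rewrite integral_indic// setIT.
rewrite -ge0_integralZl_EFin//; last exact/measurable_EFinP.
apply: lower_integral_restrict => x; first by rewrite mule_ge0.
rewrite indicE; have [/set_mem Sx|_] := boolP (x \in S).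
  by rewrite mule1 /patch mem_set ?ef//; exact: SD.
rewrite mule0 /patch; case: ifPn => // /set_mem; exact: f0.
Qed.

End lower_integral.

(** * The dilation factor of a matrix *)

Section dilation_factor.
Context {R : realType}.

(** For square [M] this is the absolute value of the determinant. The definition by the
    image of a cube makes sense for all sizes; it will be used for matrices with
    [\dim E] columns, where [\dim E = m] is only a proposition. *)
Definition dilation_factor m n (M : 'M[R]_(m, n)) : R :=
  fine (leb (linear_image M (cube m 1))) / 2 ^+ m.

Lemma dilation_factor_ge0 m n (M : 'M[R]_(m, n)) : 0 <= dilation_factor M.
Proof. by rewrite divr_ge0 ?exprn_ge0// fine_ge0// leb_ge0. Qed.

Lemma leb_linear_image m n (M : 'M[R]_(m, n)) X : m = n -> compact X ->
  leb (linear_image M X) = ((dilation_factor M)%:E * leb X)%E.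
Proof.
move=> mn; subst n => cX; have [c [c0 _ cM]] := dilation M.
rewrite cM// /dilation_factor cM; last exact: compact_cube.
by rewrite leb_cube// mulr1 -EFinM/= mulfK// gt_eqF// exprn_gt0.
Qed.

Lemma linear_image_cube m n (M : 'M[R]_(m, n)) b c : 0 <= c ->
  (forall i k, `|M i k| <= b) -> linear_image M (cube m c) `<=` cube n (m%:R * (c * b)).
Proof.
move=> c0 Mb _ [x xc <-] k; rewrite mxE (le_trans (ler_norm_sum _ _ _))//.
rewrite mulr_natl -[X in _ *+ X]card_ord -sumr_const; apply: ler_sum => i _.
by rewrite normrM ler_pM.
Qed.

Lemma dilation_factor_le m n (M : 'M[R]_(m, n)) b : m = n ->
  (forall i k, `|M i k| <= b) -> 0 <= b -> dilation_factor M <= (m%:R * b) ^+ m.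
Proof.
move=> mn Mb b0; rewrite ler_pdivrMr ?exprn_gt0// -exprMn mulrC -lee_fin.
rewrite fineK; last exact/leb_fin/compact_linear_image/compact_cube.
have := linear_image_cube ler01 Mb; rewrite mul1r => sub.
apply: (le_trans (le_leb _ _ sub)); [|exact: mrow_cube|].
  by apply: compact_mrow; apply: compact_linear_image; exact: compact_cube.
by rewrite leb_cube ?mulr_ge0// -mn.
Qed.

Lemma det_le m (M : 'M[R]_m) b : (forall i k, `|M i k| <= b) -> `|\det M| <= m`!%:R * b ^+ m.
Proof.
move=> Mb; rewrite (le_trans (ler_norm_sum _ _ _))//.
rewrite -(card_Sn m) mulr_natl -sumr_const; apply: ler_sum => s _.
rewrite normrM normrX normrN1 expr1n mul1r normr_prod.
rewrite -[X in b ^+ X]card_ord -prodr_const; apply: ler_prod => i _.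
by rewrite normr_ge0 Mb.
Qed.

(** The entries of the inverse of [M] are bounded through the adjugate, so the image of
    the unit cube contains a cube of fixed size. The bound [r] is chosen before [n], since
    it has to be uniform over the subspaces [E]. *)
Lemma dilation_factor_lower m (b e : R) : 0 < b -> 0 < e ->
  exists2 r, 0 < r & forall n (M : 'M[R]_(m, n)), m = n ->
    (forall i k, `|M i k| <= b) -> e <= \det (M *m M^T) -> r <= dilation_factor M.
Proof.
move=> b0 e0; pose c := (m.-1)`!%:R * b ^+ m.-1 * (1 + e^-1).
have c0 : 0 < c.
  by rewrite mulr_gt0 ?addr_gt0 ?invr_gt0// mulr_gt0 ?exprn_gt0// ltr0n fact_gt0.
pose r := (m.+1%:R * c)^-1; have r0 : 0 < r by rewrite invr_gt0 mulr_gt0.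
exists (r ^+ m) => [|n M mn]; first by rewrite exprn_gt0.
subst n => Mb; rewrite det_mulmx det_tr -expr2 => eM.
have d0 : \det M != 0 by apply: contraTneq eM => ->; rewrite expr0n/= -ltNge.
have uM : M \in unitmx by rewrite unitmxE unitfE.
have invM i k : `|invmx M i k| <= c.
  rewrite /invmx uM mxE normrM mulrC; apply: ler_pM => //.
    rewrite mxE /cofactor normrM normrX normrN1 expr1n mul1r.
    by apply: det_le => u v; rewrite !mxE.
  have [d1|d1] := leP 1 `|\det M|.
    rewrite normfV (le_trans (y := 1))// ?invf_le1 ?normr_gt0//.
    by rewrite lerDl invr_ge0 ltW.
  apply: (@le_trans _ _ e^-1); last by rewrite lerDr.
  rewrite normfV lef_pV2 ?posrE ?normr_gt0//.
  apply: (le_trans eM); rewrite -real_normK ?num_real// expr2.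
  by rewrite ler_piMr// ltW.
rewrite ler_pdivlMr ?exprn_gt0// -exprMn mulrC -lee_fin fineK; last first.
  exact/leb_fin/compact_linear_image/compact_cube.
rewrite -(leb_cube m (ltW r0)); apply: le_leb; first exact: mrow_cube.
  by apply: compact_mrow; apply: compact_linear_image; exact: compact_cube.
move=> x xr; exists (x *m invmx M); last by rewrite mulmxKV.
move=> k; have xrc : linear_image (invmx M) (cube m r) (x *m invmx M) by exists x.
apply: (le_trans (linear_image_cube (ltW r0) invM xrc k)).
rewrite /r invfM -(mulrA m.+1%:R^-1) mulVf ?gt_eqF// mulr1.
by rewrite ler_pdivrMr// mul1r ler_nat.
Qed.

End dilation_factor.

(** * Orthonormal frames and rotations *)

Section frames.
Context {R : realType}.

Lemma orthonormal_row_free m n (P : 'M[R]_(m, n)) : P *m P^T = 1%:M -> row_free P.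
Proof. by move=> PP; apply/row_freeP; exists P^T. Qed.

Lemma orthonormal_decomposition m n (P : 'M[R]_(m, n)) : row_free P ->
  exists A Q, [/\ A \in unitmx, Q *m Q^T = 1%:M & P = A *m Q].
Proof.
move=> fP; pose X := [tuple row i P | i < m].
have fX : free X.
  apply/freeP => k sk i.
  have /eqP : (\row_i k i) *m P = 0.
    rewrite mulmx_sum_row -[RHS]sk; apply: eq_bigr => l _.
    by rewrite mxE -tnth_nth tnth_mktuple.
  by rewrite mulmx_free_eq0// => /eqP/rowP/(_ i); rewrite !mxE.
have dX : m = \dim <<X>> by rewrite (eqP fX) size_tuple.
have [Q QX] : exists Q : 'M[R]_(m, n), orthonormal_in <<X>>%VS Q.
  by have := onbasis_exists <<X>>%VS; rewrite -dX.
have [QQ _] := QX.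
have PQ : P = P *m Q^T *m Q.
  apply/row_matrixP => i; rewrite !row_mul (orthonormal_generates dX QX)//.
  by rewrite memv_span//; apply/mapP; exists i => //; rewrite mem_enum.
exists (P *m Q^T), Q; split=> //; rewrite -row_free_unit -row_leq_rank.
by apply: (@leq_trans (\rank P)); [rewrite (eqP fP)|rewrite {1}PQ mxrankM_maxl].
Qed.

Lemma orthonormal_complement m k (P : 'M[R]_(m, m + k)) : P *m P^T = 1%:M ->
  exists Q : 'M[R]_(k, m + k), Q *m Q^T = 1%:M /\ Q *m P^T = 0.
Proof.
move=> PP; pose f : 'Hom('rV[R]_(m + k), 'rV[R]_m) := linfun (mulmxr P^T).
have dk : \dim (lker f) = k.
  have := limg_ker_dim f fullv; rewrite capfv dimvf (_ : limg f = fullv).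
    by rewrite dimvf /dim/= !mul1n => /eqP; rewrite addnC eqn_add2l => /eqP.
  apply/eqP; rewrite eqEsubv subvf/=; apply/subvP => y _.
  rewrite (_ : y = f (y *m P)) ?memv_img ?memvf//.
  by rewrite lfunE/= -mulmxA PP mulmx1.
have [Q [QQ QP]] : exists Q : 'M[R]_(k, m + k), orthonormal_in (lker f) Q.
  by have := onbasis_exists (lker f); rewrite dk.
exists Q; split=> //; apply/row_matrixP => i; rewrite row_mul row0.
by have := QP i; rewrite memv_ker lfunE/= => /eqP.
Qed.

Lemma orthogonal_det m (s : R) : (0 < m)%N -> s * s = 1 ->
  exists D : 'M[R]_m, D *m D^T = 1%:M /\ \det D = s.
Proof.
case: m => // m _ ss; exists (diag_mx (\row_i if i == 0 then s else 1)); split.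
  rewrite tr_diag_mx mulmx_diag -diag_const_mx; congr diag_mx.
  by apply/rowP => i; rewrite !mxE; case: eqP => _; rewrite ?ss ?mulr1.
rewrite det_diag (bigD1 0)//= mxE eqxx big1 ?mulr1// => i /negbTE i0.
by rewrite mxE i0.
Qed.

(** Completing both frames to orthonormal bases gives an orthogonal matrix that takes
    [P] to [Q]. The orthogonal matrix [D] corrects its determinant; as [D] only mixes the
    rows of [Q], this also works for [k = 0]. *)
Lemma rotation_between m k (P Q : 'M[R]_(m, m + k)) : (0 < m)%N ->
  P *m P^T = 1%:M -> Q *m Q^T = 1%:M ->
  exists g D, [/\ rotation g, D \in unitmx & P *m g = D *m Q].
Proof.
move=> m0 PP QQ.
have [P' [PP' P'P]] := orthonormal_complement PP.
have [Q' [QQ' Q'Q]] := orthonormal_complement QQ.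
have frame (A : 'M[R]_(m, m + k)) A' : A *m A^T = 1%:M -> A' *m A'^T = 1%:M ->
    A' *m A^T = 0 -> col_mx A A' *m (col_mx A A')^T = 1%:M.
  move=> AA AA' A'A; have AA'T : A *m A'^T = 0.
    by rewrite -[A *m _]trmxK trmx_mul trmxK A'A trmx0.
  by rewrite tr_col_mx mul_col_row AA AA' A'A AA'T [RHS]scalar_mx_block.
pose G := col_mx P P'; pose G' := col_mx Q Q'.
have GG : G *m G^T = 1%:M by exact: frame.
have GG' : G' *m G'^T = 1%:M by exact: frame.
have GTG : G^T *m G = 1%:M by exact: mulmx1C.
have detP (A : 'M[R]_(m + k)) : A *m A^T = 1%:M -> \det A * \det A = 1.
  by move=> /(congr1 determinant); rewrite det_mulmx det_tr det1.
pose s := \det G * \det G'.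
have ss : s * s = 1 by rewrite /s mulrACA !detP// mulr1.
have [D [DD detD]] := orthogonal_det m0 ss.
pose L := block_mx D 0 0 1%:M : 'M[R]_(m + k).
have LL : L *m L^T = 1%:M.
  rewrite tr_block_mx !trmx0 trmx1 mulmx_block !mul0mx !mulmx0 !addr0 !add0r.
  by rewrite DD mulmx1 [RHS]scalar_mx_block.
exists (G^T *m L *m G'), D; split.
- split.
    rewrite !trmx_mul trmxK !mulmxA -(mulmxA _ G' G'^T) GG' mulmx1.
    by rewrite -(mulmxA _ L L^T) LL mulmx1 GTG.
  rewrite !det_mulmx det_tr det_ublock det1 mulr1 detD /s.
  by rewrite !mulrA (detP _ GG) mul1r (detP _ GG').
- by have [] := mulmx1_unit DD.
rewrite !mulmxA (_ : P *m G^T = row_mx 1%:M 0).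
  by rewrite mul_row_block mul_row_col !(mul1mx, mul0mx, mulmx0, addr0, add0r).
rewrite /G tr_col_mx mul_mx_row PP (_ : P *m P'^T = 0)//.
by rewrite -[P *m _]trmxK trmx_mul trmxK P'P trmx0.
Qed.

End frames.

(** * Subspaces transversal to a frame *)

Section haar.
Context {R : realType}.
Local Notation subs n := (borel_subspaces R n).

Lemma measurable_oproj_preimage n (O : set 'M[R]_n) : open O ->
  measurable ((fun E => oproj_mx E) @^-1` O : set (subs n)).
Proof.
move=> oO; apply: sub_sigma_algebra; apply: open_comp => // E _.
exact: initial_continuous.
Qed.

Lemma trace_oproj_mx n (E : {vspace 'rV[R]_n}) : \tr (oproj_mx E) = (\dim E)%:R.
Proof. by rewrite oproj_mxE mxtrace_mulC onbasis_orthonormal mxtrace1. Qed.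

(** The dimension of [E] is the trace of the projection to [E], which depends
    continuously on [E]. *)
Lemma measurable_grassmannian n j : measurable (grassmannian j : set (subs n)).
Proof.
have -> : (grassmannian j : set (subs n)) =
    ~` ((fun E => oproj_mx E) @^-1` [set A | \tr A != j%:R]).
  apply/seteqP; split=> E /=; rewrite trace_oproj_mx; first by move=> ->; rewrite eqxx.
  by move=> /negP; rewrite negbK eqr_nat => /eqP.
apply: measurableC; apply: measurable_oproj_preimage.
apply: (@open_comp _ _ (fun A : 'M[R]_n => \tr A) [set t | t != j%:R]) => [A _|].
  apply: continuous_sum => i {}A; exact: coord_continuous.
exact: open_neq.
Qed.

(** [gram P E] is the Gram matrix of the projections to [E] of the rows of [P]. *)
Definition gram n m (P : 'M[R]_(m, n)) (E : {vspace 'rV[R]_n}) : 'M[R]_m :=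
  P *m oproj_mx E *m P^T.

Lemma gramE n m (P : 'M[R]_(m, n)) E :
  gram P E = (P *m (onbasis E)^T) *m (P *m (onbasis E)^T)^T.
Proof. by rewrite /gram oproj_mxE trmx_mul trmxK !mulmxA. Qed.

Lemma det_gram_ge0 n m (P : 'M[R]_(m, n)) E : \dim E = m -> 0 <= \det (gram P E).
Proof.
move=> dE; rewrite gramE; move: (P *m _) => M; move: M; rewrite dE => M.
by rewrite det_mulmx det_tr -expr2 sqr_ge0.
Qed.

(** The rows of [P] project to a basis of [E]. *)
Definition transversal n m (P : 'M[R]_(m, n)) : set (subs n) :=
  grassmannian m `&` [set E | \det (gram P E) != 0].

Lemma open_det_gram n m (P : 'M[R]_(m, n)) (O : set R) : open O ->
  open [set A | O (\det (P *m A *m P^T))].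
Proof.
move=> oO; apply: (@open_comp _ _ (fun A : 'M[R]_n => \det (P *m A *m P^T)) O) => // A _.
apply: continuous_det => {}A; apply: continuous_mulmx => {}A; last exact: cst_continuous.
by apply: continuous_mulmx => {}A; [exact: cst_continuous|exact: cvg_id].
Qed.

Lemma measurable_transversal n m (P : 'M[R]_(m, n)) : measurable (transversal P).
Proof.
apply: measurableI; first exact: measurable_grassmannian.
apply: (@measurable_oproj_preimage _ [set A | \det (P *m A *m P^T) != 0]).
by apply: (@open_det_gram _ _ P [set t | t != 0]); exact: open_neq.
Qed.

Lemma transversal_unit n m (A : 'M[R]_m) (P : 'M[R]_(m, n)) : A \in unitmx ->
  transversal (A *m P) = transversal P.
Proof.
rewrite unitmxE unitfE => dA; congr (_ `&` _); apply/funext => E /=.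
have -> : gram (A *m P) E = A *m gram P E *m A^T by rewrite /gram trmx_mul !mulmxA.
by rewrite !det_mulmx det_tr !mulf_eq0 (negbTE dA) orbF.
Qed.

Lemma transversal_rotate n m (g : 'M[R]_n) (P : 'M[R]_(m, n)) : rotation g ->
  rotate g @^-1` transversal (P *m g) = transversal P.
Proof.
move=> [gg _]; have gramg E : gram (P *m g) (rotate g E) = gram P E.
  rewrite /gram oproj_mx_rotate// trmx_mul !mulmxA -(mulmxA _ g g^T) gg mulmx1.
  by rewrite -(mulmxA _ g g^T) gg mulmx1.
apply/seteqP; split=> E [dE dg]; split.
- by move: dE; rewrite /grassmannian/= dim_rotate.
- by move: dg; rewrite /= gramg.
- by rewrite /grassmannian/= dim_rotate.
- by rewrite /= gramg.
Qed.

Lemma coordinate_orthonormal n m (f : 'I_m -> 'I_n) : injective f ->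
  rowsub f 1%:M *m (rowsub f 1%:M)^T = 1%:M :> 'M[R]_m.
Proof.
move=> injf; rewrite -rowsubE; apply/matrixP => i k; rewrite !mxE.
by rewrite (inj_eq injf) eq_sym.
Qed.

(** Some minor of maximal size of an orthonormal basis of [E] is nonzero. *)
Lemma grassmannian_transversal n m : (grassmannian m : set (subs n)) `<=`
  \bigcup_(f in [set f : {ffun 'I_m -> 'I_n} | injectiveb f]) transversal (rowsub f 1%:M : 'M[R]_(m, n)).
Proof.
move=> E dE; have fE : row_full (onbasis E)^T.
  by rewrite /row_full mxrank_tr; exact/orthonormal_row_free/onbasis_orthonormal.
move: (fullrankfun fE) (@fullrankfun_inj _ _ _ _ fE) (fullrowsub_full fE) => f injf fullf.
suff [h [injh dh]] : exists h : {ffun 'I_(\dim E) -> 'I_n},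
    injective h /\ \det (gram (rowsub h 1%:M) E) != 0.
  move: h injh dh; rewrite dE => h injh dh; exists h => //=; exact/injectiveP.
exists f; split=> //; rewrite gramE -rowsubE det_mulmx det_tr mulf_neq0 -?unitfE -?unitmxE//;
  by rewrite -row_full_unit.
Qed.

(** If the set were null for [P], then by invariance of [sigma] for all orthonormal
    frames, in particular for the finitely many coordinate frames, whose transversal
    subspaces cover the Grassmannian. *)
Lemma transversal_measure n j (sigma : probability (subs n) R) (P : 'M[R]_(j, n)) :
  (0 < j <= n)%N -> haar_grassmannian j sigma -> row_free P ->
  (0 < sigma (transversal P))%E.
Proof.
move=> /andP[j0 jn] [sG sR] fP; rewrite lt_neqAle measure_ge0 andbT eq_sym.
apply/eqP => sP0.
have sQ0 (Q : 'M[R]_(j, n)) : Q *m Q^T = 1%:M -> sigma (transversal Q) = 0%E.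
  move=> QQ; have [k nk] : exists k, n = (j + k)%N by exists (n - j)%N; rewrite subnKC.
  subst n; have [A [P0 [uA PP0 PE]]] := orthonormal_decomposition fP.
  have [g [D [rg uD PgQ]]] := rotation_between j0 PP0 QQ.
  rewrite -(transversal_unit Q uD) -PgQ -(sR g rg _ (measurable_transversal _)).
  by rewrite transversal_rotate// -sP0 PE transversal_unit.
have : (sigma (grassmannian j) <= \sum_(f \in [set f : {ffun 'I_j -> 'I_n} | injectiveb f])
    sigma (transversal (rowsub f 1%:M : 'M[R]_(j, n))))%E.
  apply: content_sub_fsum => [|f _||].
  - exact: finite_finset.
  - exact: measurable_transversal.
  - exact: measurable_grassmannian.
  - exact: grassmannian_transversal.
rewrite sG fsbig1 => [|f /injectiveP injf]; last exact/sQ0/coordinate_orthonormal.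
by rewrite lee_fin ler10.
Qed.

End haar.

(** * Intrinsic volumes *)

Section intrinsic_volume.
Context {R : realType} {n j : nat} (sigma : probability (borel_subspaces R n) R).
Local Notation V := (intrinsic_volume sigma j).
Local Notation G := (grassmannian j : set (borel_subspaces R n)).

Lemma projection_bounded (K : set 'rV[R]_n) : compact K -> exists2 b, 0 <= b &
  forall E, G E -> (leb (linear_image (onbasis E)^T K) <= b%:E)%E.
Proof.
move=> cK; have [c c0 Kc] := compact_sub_cube cK.
exists ((2 * (n%:R * (c * 1))) ^+ j) => [|E <-].
  by rewrite exprn_ge0// !mulr_ge0// ltW.
rewrite -leb_cube; last by rewrite !mulr_ge0// ltW.
apply: le_leb; [|exact: mrow_cube|].
  by apply: compact_mrow; exact: compact_linear_image.
apply: (subset_trans _ (linear_image_cube (ltW c0) _)) => [_ [x Kx <-]|i k].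
  by exists x => //; exact: Kc.
by rewrite mxE onbasis_entry.
Qed.

Lemma intrinsic_volumeE K : V K =
  ((('C(n, j))%:R^-1)%:E * \int[sigma]_(E in G) leb (linear_image (onbasis E)^T K))%E.
Proof. by congr (_ * _)%E; apply: eq_integral => E _; exact: Vol_oproj. Qed.

Let invC_ge0 : 0 <= ('C(n, j))%:R^-1 :> R. Proof. by rewrite invr_ge0. Qed.

Lemma le_intrinsic_volume K L : compact K -> compact L -> K `<=` L -> (V K <= V L)%E.
Proof.
move=> cK cL KL; rewrite !intrinsic_volumeE lee_wpmul2l ?lee_fin//.
apply: le_lower_integral => E _; first exact: leb_ge0.
apply: le_leb; [apply: compact_mrow; exact: compact_linear_image..|].
by move=> _ [x Kx <-]; exists x => //; exact: KL.
Qed.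

(** This is [leb_add_zonotope] in all subspaces at once: a projection of a zonotope is a
    zonotope, and the error is bounded uniformly in the subspace. *)
Lemma intrinsic_volume_add_zonotope K vs : compact K -> convex K -> exists2 c, 0 <= c &
  forall N, (0 < N)%N -> (V (minkowski_sum K (zonotope N%:R^-1 vs)) <= V K + (c / N%:R)%:E)%E.
Proof.
move=> cK xK.
have cKz : compact (minkowski_sum K (zonotope 1 vs)).
  by apply: compact_minkowski_sum => //; exact: compact_zonotope.
have [b b0 bP] := projection_bounded cKz.
pose c := (size vs)%:R * b; have c0 : 0 <= c by rewrite mulr_ge0.
exists (('C(n, j))%:R^-1 * c) => [|N N0]; first by rewrite mulr_ge0.
have cN0 : 0 <= c / N%:R by rewrite divr_ge0.
rewrite !intrinsic_volumeE -mulrA EFinM -ge0_muleDr ?lee_fin//; last first.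
  by apply: integral_ge0 => E _; exact: leb_ge0.
rewrite lee_wpmul2l ?lee_fin//; apply: lower_integral_le_add => //.
  exact: probability_le1.
move=> E GE; rewrite linear_image_sum linear_image_zonotope.
apply: (le_trans (leb_add_zonotope _ _ _ N0)).
- exact: compact_linear_image.
- exact: convex_linear_image.
rewrite -linear_image_zonotope -linear_image_sum size_map leeD2l//.
rewrite /c mulrAC [leRHS]EFinM; apply: lee_wpmul2l; last exact: bP.
by rewrite lee_fin divr_ge0.
Qed.

(** In the coordinates of [E], the projection of [linear_image P X] is the image of [X]
    under a square matrix. So [k] is the mean of the dilation factors of these matrices.
    It is finite because their entries are bounded, and positive because the
    determinants of the Gram matrices exceed some [k.+1%:R^-1] on a set of positive
    measure, where the dilation factors are bounded below. *)
Lemma intrinsic_volume_linear (P : 'M[R]_(j, n)) : (0 < j <= n)%N ->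
  haar_grassmannian j sigma -> row_free P ->
  exists2 k, 0 < k & forall X, compact X -> V (linear_image P X) = (k%:E * leb X)%E.
Proof.
move=> /andP[j0 jn] haar fP.
pose df E := dilation_factor (P *m (onbasis E)^T).
have df0 E : (0 <= (df E)%:E)%E by rewrite lee_fin dilation_factor_ge0.
have C0 : 0 < ('C(n, j))%:R^-1 :> R by rewrite invr_gt0 ltr0n bin_gt0.
pose b := n%:R * `|P| + 1.
have b0 : 0 < b by rewrite ltr_wpDl// mulr_ge0.
have Pb E i k : `|(P *m (onbasis E)^T) i k| <= b.
  rewrite mxE (le_trans (ler_norm_sum _ _ _))// (@le_trans _ _ (n%:R * `|P|)) ?lerDl//.
  rewrite mulr_natl -[X in _ *+ X]card_ord -sumr_const; apply: ler_sum => l _.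
  by rewrite normrM mxE -[leRHS]mulr1 ler_pM ?onbasis_entry ?entry_le_norm.
have VE X : compact X -> V (linear_image P X) =
    (('C(n, j)%:R^-1)%:E * \int[sigma]_(E in G) (df E)%:E * leb X)%E.
  move=> cX; rewrite intrinsic_volumeE -muleA; congr (_ * _)%E.
  have /fineK <- := leb_fin cX; rewrite muleC -lower_integralZ//; last first.
    by rewrite fine_ge0// leb_ge0.
  apply: eq_integral => E; rewrite inE => GE.
  by rewrite linear_image_comp leb_linear_image// fineK ?leb_fin// muleC.
have Ile : (\int[sigma]_(E in G) (df E)%:E <= ((j%:R * b) ^+ j)%:E)%E.
  rewrite -[leRHS]add0e -[X in (X + _)%E](integral0 sigma G).
  apply: lower_integral_le_add => //.
  - exact: probability_le1.
  - by rewrite exprn_ge0// mulr_ge0// ltW.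
  - by move=> E GE; rewrite add0e lee_fin dilation_factor_le// ltW.
have Igt0 : (0 < \int[sigma]_(E in G) (df E)%:E)%E.
  pose S k := G `&` [set E | k.+1%:R^-1 < \det (gram P E)].
  have mS k : measurable (S k : set (borel_subspaces R n)).
    apply: measurableI; first exact: measurable_grassmannian.
    apply: (@measurable_oproj_preimage _ _ [set A | k.+1%:R^-1 < \det (P *m A *m P^T)]).
    by apply: (@open_det_gram _ _ _ P [set t | k.+1%:R^-1 < t]); exact: open_gt.
  have [k Sk] : exists k, (0 < sigma (S k))%E.
    apply: contrapT => nS; have := transversal_measure (P := P) _ haar fP.
    rewrite j0 jn => /(_ isT); rewrite (_ : sigma _ = 0%E) ?ltxx//.
    apply: measure_negligible; first exact: measurable_transversal.
    have negS : sigma.-negligible (\bigcup_k S k).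
      apply: negligible_bigcup => k; apply/negligibleP => //.
      by apply/eqP; rewrite -measure_le0 leNgt; apply/negP => Sk; apply: nS; exists k.
    apply: negligibleS negS => E [dE /= dg].
    have d0 : 0 < \det (gram P E) by rewrite lt_neqAle eq_sym dg det_gram_ge0.
    by have [k kd] := invS_lt d0; exists k.
  have k0 : 0 < k.+1%:R^-1 :> R by rewrite invr_gt0.
  have [r r0 rP] := dilation_factor_lower j b0 k0.
  apply: (@lt_le_trans _ _ (r%:E * sigma (S k))%E); first by rewrite mule_gt0.
  apply: lower_integral_ge => // [E []//||E [GE kE]]; first exact: ltW.
  by rewrite lee_fin rP// -gramE ltW.
have Ifin : (\int[sigma]_(E in G) (df E)%:E)%E \is a fin_num.
  by rewrite ge0_fin_numE ?(le_lt_trans Ile) ?ltry// ltW.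
exists ('C(n, j)%:R^-1 * fine (\int[sigma]_(E in G) (df E)%:E)%E) => [|X cX].
  by rewrite mulr_gt0// fine_gt0// Igt0 (le_lt_trans Ile) ?ltry.
by rewrite VE// EFinM fineK.
Qed.

End intrinsic_volume.

(** * Double cones over a triangle and a hexagon *)

Section gauge.
Context {R : realType}.

(** A norm on the plane that need not be even. The last two conditions make its balls
    bounded with nonempty interior; [3] is a constant that suits both norms below. *)
Definition asymmetric_norm (phi : R -> R -> R) : Prop :=
  [/\ forall s t s' t', phi (s + s') (t + t') <= phi s t + phi s' t',
      forall c s t, 0 <= c -> phi (c * s) (c * t) = c * phi s t,
      forall s t, `|s| <= phi s t /\ `|t| <= phi s t
    & forall s t, phi s t <= 3 * (`|s| + `|t|)].

(** The balls are iterated double cones over the balls of [phi], which is applied to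
    the last two coordinates. *)
Fixpoint gauge (phi : R -> R -> R) m : 'rV[R]_m.+2 -> R :=
  if m is m'.+1 then fun x : 'rV[R]_(1 + m'.+2) => `|x 0 0| + gauge phi (rsubmx x)
  else fun x => phi (x 0 0) (x 0 1).

Definition gauge_ball phi m r : set 'rV[R]_m.+2 := [set x | gauge phi x <= r].

Variable phi : R -> R -> R.
Hypothesis phiN : asymmetric_norm phi.

Lemma gaugeD m (x y : 'rV[R]_m.+2) : gauge phi (x + y) <= gauge phi x + gauge phi y.
Proof.
have [phiD _ _ _] := phiN.
elim: m x y => [|m IH] x y /=; first by rewrite !mxE phiD.
have -> : @rsubmx _ 1 1 m.+2 (x + y) = rsubmx (x : 'rV_(1 + m.+2)) + rsubmx (y : 'rV_(1 + m.+2)).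
  by apply/rowP => k; rewrite !mxE.
rewrite mxE addrACA lerD ?ler_normD//; exact: IH.
Qed.

Lemma gaugeZ m c (x : 'rV[R]_m.+2) : 0 <= c -> gauge phi (c *: x) = c * gauge phi x.
Proof.
have [_ phiZ _ _] := phiN => c0.
elim: m x => [|m IH] x /=; first by rewrite !mxE phiZ.
have -> : @rsubmx _ 1 1 m.+2 (c *: x) = c *: rsubmx (x : 'rV_(1 + m.+2)).
  by apply/rowP => k; rewrite !mxE.
by rewrite mxE IH mulrDr normrM ger0_norm.
Qed.

Lemma gauge_ge0 m (x : 'rV[R]_m.+2) : 0 <= gauge phi x.
Proof.
have [_ _ phi_ge _] := phiN.
elim: m x => [|m IH] x /=; last by rewrite addr_ge0//; exact: IH.
by have [+ _] := phi_ge (x 0 0) (x 0 1); exact: le_trans.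
Qed.

Lemma coord_le_gauge m (x : 'rV[R]_m.+2) k : `|x 0 k| <= gauge phi x.
Proof.
have [_ _ phi_ge _] := phiN.
elim: m x k => [|m IH] x k /=.
  have [x0 x1] := phi_ge (x 0 0) (x 0 1).
  by case: (unliftP 0 k) => [l ->|-> //]; rewrite (ord1 l) (_ : lift 0 0 = 1)//; exact/val_inj.
rewrite -[k](splitK (m := 1)); case: fintype.split => l /=.
  rewrite (_ : lshift _ l = 0) ?lerDl ?gauge_ge0//.
  by apply/val_inj; rewrite /= (ord1 l).
have := IH (@rsubmx _ 1 1 m.+2 x) l; rewrite mxE => /le_trans; apply.
by rewrite lerDr.
Qed.

(** The [m] first coordinates contribute at most [c] each, and [phi] at most
    [3 * (c + c)]. *)
Lemma gauge_le m (x : 'rV[R]_m.+2) c : (forall k, `|x 0 k| <= c) -> gauge phi x <= (m + 6)%:R * c.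
Proof.
have [_ _ _ phi_le] := phiN.
elim: m x => [|m IH] x xc /=.
  rewrite (le_trans (phi_le _ _))//; have := xc 0; have := xc 1; lra.
rewrite (_ : (m.+1 + 6)%:R = 1 + (m + 6)%:R) ?mulrDl ?mul1r ?nat1r// lerD//.
by apply: IH => k; rewrite mxE.
Qed.

Lemma convex_gauge_ball m r : convex (@gauge_ball phi m r).
Proof.
move=> x y t /= xr yr /andP[t0 t1]; rewrite /gauge_ball/= (le_trans (gaugeD _ _))//.
rewrite !gaugeZ ?subr_ge0// [leRHS](_ : r = t * r + (1 - t) * r); last by ring.
by rewrite lerD// ler_wpM2l// subr_ge0.
Qed.

Lemma compact_gauge_ball m r : compact (@gauge_ball phi m r).
Proof.
apply: bounded_closed_compact.
  exists `|r|; split=> [|M rM x xr]; first exact: num_real.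
  have M0 : 0 <= M by rewrite (le_trans _ (ltW rM)).
  apply/cubeE => // k; apply: (le_trans (coord_le_gauge x k)); apply: (le_trans xr).
  exact: le_trans (ler_norm r) (ltW rM).
rewrite -[gauge_ball _ _]setCK; apply: open_closedC; rewrite openE => x /negP.
rewrite -ltNge => rx; pose e := (gauge phi x - r) / (m + 6).+1%:R.
have e0 : 0 < e by rewrite divr_gt0// subr_gt0.
apply/nbhs_ballP; exists e => //= y; rewrite -ball_normE/= => xye.
apply/negP; rewrite -ltNge.
have := gaugeD y (x - y); rewrite addrC subrK => xy.
have /(_ (x - y) e) := @gauge_le m.
have xy' k : `|(x - y) 0 k| <= e.
  by move: (ltW xye) => /cubeE; apply; exact: ltW.
move=> /(_ xy') ge.
have : (m + 6)%:R * e < gauge phi x - r.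
  by rewrite /e mulrCA gtr_pMr ?subr_gt0// ltr_pdivrMr// mul1r ltr_nat.
move: ge xy; set a := _%:R * e; lra.
Qed.

End gauge.

Section area.
Context {R : realType}.

(** The unit ball is the triangle with vertices [(1, 0)], [(0, 1)], [(-1, -1)]. *)
Definition triangle_norm (s t : R) : R := Num.max (s + t) (Num.max (t - 2 * s) (s - 2 * t)).

(** The unit ball is the convex hull of the vertices of the triangle and their
    opposites, scaled by [5 / 7]. *)
Definition hexagon_norm (s t : R) : R := 7 / 5 * Num.max `|s| (Num.max `|t| `|s - t|).

Lemma triangle_norm_le s t c : (triangle_norm s t <= c) =
  [&& s + t <= c, t - 2 * s <= c & s - 2 * t <= c].
Proof. by rewrite /triangle_norm !ge_max. Qed.

Lemma hexagon_norm_le s t c : (hexagon_norm s t <= c) =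
  [&& `|s| <= 5 / 7 * c, `|t| <= 5 / 7 * c & `|s - t| <= 5 / 7 * c].
Proof.
rewrite /hexagon_norm -ler_pdivlMl ?divr_gt0// !ge_max.
by rewrite (_ : (7 / 5)^-1 * c = 5 / 7 * c)//; field.
Qed.

Lemma triangle_normP : asymmetric_norm triangle_norm.
Proof.
have le_self s t : [&& s + t <= triangle_norm s t, t - 2 * s <= triangle_norm s t
    & s - 2 * t <= triangle_norm s t] by rewrite -triangle_norm_le.
split.
- move=> s t s' t'; rewrite triangle_norm_le.
  have /and3P[a b c] := le_self s t; have /and3P[a' b' c'] := le_self s' t'.
  by apply/and3P; split; lra.
- move=> c s t c0; rewrite /triangle_norm.
  by rewrite -!mulrDr !(mulrCA 2) -!mulrBr -!maxr_pMr.
- move=> s t; have /and3P[a b c] := le_self s t.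
  by split; rewrite ler_norml; apply/andP; split; lra.
- move=> s t; rewrite triangle_norm_le; have := ler_norm s; have := ler_norm t.
  have := ler_norm (- s); have := ler_norm (- t); rewrite !normrN.
  by move=> *; apply/and3P; split; lra.
Qed.

Lemma hexagon_normP : asymmetric_norm hexagon_norm.
Proof.
have le_self s t : [&& `|s| <= 5 / 7 * hexagon_norm s t, `|t| <= 5 / 7 * hexagon_norm s t
    & `|s - t| <= 5 / 7 * hexagon_norm s t] by rewrite -hexagon_norm_le.
split.
- move=> s t s' t'; rewrite hexagon_norm_le.
  have /and3P[a b c] := le_self s t; have /and3P[a' b' c'] := le_self s' t'.
  have := ler_normD s s'; have := ler_normD t t'.
  have := ler_normD (s - t) (s' - t'); rewrite addrACA -opprD => *.
  by apply/and3P; split; lra.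
- move=> c s t c0; rewrite /hexagon_norm -mulrBr !normrM (ger0_norm c0).
  by rewrite -!maxr_pMr// mulrCA.
- move=> s t; have /and3P[a b c] := le_self s t.
  by have := normr_ge0 s; have := normr_ge0 t; split; lra.
- move=> s t; rewrite hexagon_norm_le; have := ler_normB s t.
  have := normr_ge0 s; have := normr_ge0 t.
  by move=> *; apply/and3P; split; lra.
Qed.

Lemma integral_affine (a b p q : R) : a <= b ->
  (\int[lebesgue_measure]_(s in `[a, b]) (p + q * s)%:E =
    (p * (b - a) + q * (b ^+ 2 - a ^+ 2) / 2)%:E)%E.
Proof.
rewrite le_eqVlt => /predU1P[->|ab].
  by rewrite set_itv1 integral_set1; congr EFin; ring.
pose F (s : R) := p * s + q / 2 * s ^+ 2.
have dF (s : R) : is_derive s 1 F (p + q * s).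
  apply: is_derive_eq; rewrite /GRing.scale/=; by field.
have cF : forall u, {for u, continuous F}.
  move=> u; apply: differentiable_continuous; exact/derivable1_diffP/ex_derive.
transitivity ((F b)%:E - (F a)%:E)%E; last first.
  by rewrite -EFinB /F; congr EFin; field.
apply: (@continuous_FTC2 R (fun s => p + q * s) F) => //.
- apply: continuous_subspaceT => s; apply: continuousD; first exact: cst_continuous.
  by apply: continuousM; [exact: cst_continuous|exact: cvg_id].
- split=> [s _||].
  + exact: ex_derive.
  + by apply: cvg_at_right_filter; exact: cF.
  + by apply: cvg_at_left_filter; exact: cF.
- by move=> s _; rewrite derive1E; exact: derive_val.
Qed.

Lemma leb_row1 (A : set R) : measurable (A : set (measurableTypeR R)) ->
  leb [set x : 'rV[R]_1 | A (x 0 0)] = lebesgue_measure A.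
Proof.
move=> mA; have mT : mrow (setT : set 'rV[R]_0) by rewrite /mrow preimage_setT.
have T1 : leb (setT : set 'rV[R]_0) = 1%E.
  have := @leb_cube R 0 0 (lexx 0); rewrite expr0 => <-; congr leb.
  by apply/seteqP; split=> // x _ [].
have := leb_prod (A := A) mA mT; rewrite T1 mule1 => <-; congr leb.
by apply/seteqP; split=> x /= => [|[]].
Qed.

Lemma gauge_ball0E (phi : R -> R -> R) r s :
  [set y | @gauge_ball _ phi 0 r (cons_row s y)] = [set y : 'rV[R]_1 | phi s (y 0 0) <= r].
Proof.
apply/funext => y; rewrite /gauge_ball/= cons_row0.
suff -> : cons_row s y 0 1 = y 0 0 by [].
transitivity (rsubmx (cons_row s y) 0 0); last by rewrite cons_rowK.
rewrite [RHS]mxE; congr (cons_row s y _ _); exact: val_inj.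
Qed.

Lemma leb_interval (a b : R) : a <= b ->
  leb [set y : 'rV[R]_1 | a <= y 0 0 <= b] = (b - a)%:E.
Proof.
move=> ab; rewrite (_ : [set _ | _] = [set y : 'rV[R]_1 | `[a, b]%classic (y 0 0)]).
  rewrite leb_row1; last exact: measurable_itv.
  rewrite lebesgue_measure_itv/= lte_fin; case: ltP => // ba.
  by congr EFin; apply/eqP; rewrite eq_sym subr_eq0 eq_le ba ab.
by apply/seteqP; split=> y /=; rewrite in_itv.
Qed.

Lemma mrow_interval (a b : R) : mrow [set y : 'rV[R]_1 | a <= y 0 0 <= b].
Proof.
rewrite (_ : [set _ | _] = [set y : 'rV[R]_1 | `[a, b]%classic (y 0 0)]).
  by apply: mrow_coord; exact: measurable_itv.
by apply/seteqP; split=> y /=; rewrite in_itv.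
Qed.

Lemma mrow_gauge_section (phi : R -> R -> R) r s : asymmetric_norm phi ->
  mrow [set y : 'rV[R]_1 | phi s (y 0 0) <= r].
Proof.
move=> phiN; rewrite -gauge_ball0E; apply: mrow_section.
by apply: compact_mrow; exact: compact_gauge_ball.
Qed.

Lemma measurable_affine (p q : R) :
  measurable_fun setT (fun s : measurableTypeR R => (p + q * s)%:E).
Proof.
apply: (@measurableT_comp _ _ _ _ _ _ (@EFin R)); first exact: EFin_measurable.
by apply: measurable_funD => //; exact: measurable_funM.
Qed.

Lemma measurable_affine_patch (p q a b : R) :
  measurable_fun setT ((fun s : measurableTypeR R => (p + q * s)%:E) \_ `[a, b]).
Proof.
apply/(measurable_restrictT _ (measurable_itv _)); apply: measurable_funTS.
exact: measurable_affine.
Qed.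

(** The section at first coordinate [s] is an interval of length [3 / 2 * (r - `|s|)]. *)
Lemma leb_triangle r : 0 <= r ->
  (leb (gauge_ball triangle_norm (m := 0) r) <= (3 / 2 * r ^+ 2)%:E)%E.
Proof.
move=> r0; rewrite (@leb_cons _ 1).
pose f1 (s : R) := (3 / 2 * r + - (3 / 2) * s)%:E.
pose f2 (s : R) := (3 / 2 * r + 3 / 2 * s)%:E.
pose D1 : set R := `[0, r]%classic.
pose D2 : set R := `[- r, 0]%classic.
pose g (s : R) := ((f1 \_ D1) s + (f2 \_ D2) s)%E.
have f10 (s : R) : (0 <= (f1 \_ D1) s)%E.
  rewrite /patch; case: ifPn => // /set_mem; rewrite /D1 /D2/= in_itv/= => /andP[s0 s1].
  by rewrite lee_fin; lra.
have f20 (s : R) : (0 <= (f2 \_ D2) s)%E.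
  rewrite /patch; case: ifPn => // /set_mem; rewrite /D1 /D2/= in_itv/= => /andP[s0 s1].
  by rewrite lee_fin; lra.
apply: (@le_trans _ _ (\int[lebesgue_measure]_s g s)%E).
  apply: le_lower_integral => s _; first exact: leb_ge0.
  rewrite gauge_ball0E.
  have le_itv a b : (forall t, triangle_norm s t <= r -> a <= t <= b) -> a <= b ->
    (leb [set y : 'rV[R]_1 | (triangle_norm s (y 0 0) <= r)%R] <= (b - a)%:E)%E.
    move=> tab ab; rewrite -leb_interval//.
    apply: le_leb => [||y /tab//]; last exact: mrow_interval.
    by apply: mrow_gauge_section; exact: triangle_normP.
  have [/andP[s0 sr]|s0r] := boolP (0 <= s <= r).
    apply: (@le_trans _ _ ((f1 \_ D1) s)); last by rewrite leeDl.
    rewrite /patch mem_set /D1 /D2/= ?in_itv/= ?s0//.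
    rewrite (_ : f1 s = ((r - s) - (s - r) / 2)%:E); last by congr EFin; field.
    apply: le_itv => [t|]; last by lra.
    by rewrite triangle_norm_le => /and3P[a b c]; apply/andP; split; lra.
  have [/andP[rs s0]|sr0] := boolP (- r <= s <= 0).
    apply: (@le_trans _ _ ((f2 \_ D2) s)); last by rewrite leeDr.
    rewrite /patch mem_set /D1 /D2/= ?in_itv/= ?rs//.
    rewrite (_ : f2 s = ((r + 2 * s) - (s - r) / 2)%:E); last by congr EFin; field.
    apply: le_itv => [t|]; last by lra.
    by rewrite triangle_norm_le => /and3P[a b c]; apply/andP; split; lra.
  rewrite (_ : [set _ | _] = set0) ?leb0 ?adde_ge0// -subset0 => y /=.
  rewrite triangle_norm_le => /and3P[a b c].
  by case/orP: (le_total 0 s) => s0; [case/negP: s0r|case/negP: sr0]; apply/andP; split; lra.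
rewrite ge0_integralD//; [|exact: measurable_affine_patch..].
rewrite -!integral_mkcond !integral_affine//; last by lra.
by rewrite -EFinD lee_fin; lra.
Qed.

(** With [c = 5 / 7 * r], the section at first coordinate [s] is an interval of length
    [2 * c - `|s|], so the area is [3 * c ^+ 2]. *)
Lemma leb_hexagon r : 0 <= r ->
  ((75 / 49 * r ^+ 2)%:E <= leb (gauge_ball hexagon_norm (m := 0) r))%E.
Proof.
move=> r0; pose c := 5 / 7 * r; have c0 : 0 <= c by rewrite /c; lra.
rewrite (@leb_cons _ 1).
pose f1 (s : R) := (2 * c + - 1 * s)%:E.
pose f2 (s : R) := (2 * c + 1 * s)%:E.
pose D1 : set R := `[0, c]%classic.
(* Half open, because at [s = 0] the summands of [g] would add up to twice the length. *)
pose D2 : set R := `[- c, 0[%classic.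
pose g (s : R) := ((f1 \_ D1) s + (f2 \_ D2) s)%E.
have f10 (s : R) : (0 <= (f1 \_ D1) s)%E.
  rewrite /patch; case: ifPn => // /set_mem; rewrite /D1 /D2/= in_itv/= => /andP[s0 s1].
  by rewrite lee_fin; lra.
have f20 (s : R) : (0 <= (f2 \_ D2) s)%E.
  rewrite /patch; case: ifPn => // /set_mem; rewrite /D1 /D2/= in_itv/= => /andP[s0 s1].
  by rewrite lee_fin; lra.
apply: (@le_trans _ _ (\int[lebesgue_measure]_s g s)%E); last first.
  apply: le_lower_integral => s _; first by rewrite adde_ge0.
  rewrite gauge_ball0E.
  have le_itv a b : (forall t, a <= t <= b -> hexagon_norm s t <= r) -> a <= b ->
    ((b - a)%:E <= leb [set y : 'rV[R]_1 | (hexagon_norm s (y 0 0) <= r)%R])%E.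
    move=> tab ab; rewrite -leb_interval//.
    apply: le_leb => [||y /tab//]; first exact: mrow_interval.
    by apply: mrow_gauge_section; exact: hexagon_normP.
  have [s0|s0] := leP 0 s.
    rewrite /g [X in (_ + X)%E](_ : _ = 0%E) ?adde0; last first.
      by rewrite /patch memNset /D1 /D2//= in_itv/= => /andP[_]; rewrite ltNge s0.
    have [sc|sc] := leP s c; last first.
      by rewrite /patch memNset /D1 /D2 ?leb_ge0//= in_itv/= s0/= leNgt sc.
    rewrite /patch mem_set /D1 /D2/= ?in_itv/= ?s0//.
    rewrite (_ : f1 s = (c - (s - c))%:E); last by congr EFin; ring.
    apply: le_itv => [t /andP[t0 t1]|]; last by lra.
    by rewrite hexagon_norm_le -/c !ler_norml; apply/and3P; split; apply/andP; split; lra.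
  rewrite /g [X in (X + _)%E](_ : _ = 0%E) ?add0e; last first.
    by rewrite /patch memNset /D1 /D2//= in_itv/= => /andP[]; rewrite leNgt s0.
  have [cs|cs] := leP (- c) s; last first.
    by rewrite /patch memNset /D1 /D2 ?leb_ge0//= in_itv/= s0 andbT leNgt cs.
  rewrite /patch mem_set /D1 /D2/= ?in_itv/= ?cs//.
  rewrite (_ : f2 s = ((s + c) - (- c))%:E); last by congr EFin; ring.
  apply: le_itv => [t /andP[t0 t1]|]; last by lra.
  by rewrite hexagon_norm_le -/c !ler_norml; apply/and3P; split; apply/andP; split; lra.
have mf2 : measurable_fun setT (f2 \_ D2).
  apply/(measurable_restrictT _ (measurable_itv _)); apply: measurable_funTS.
  exact: measurable_affine.
rewrite ge0_integralD//; last exact: measurable_affine_patch.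
rewrite -!integral_mkcond integral_itv_bndo_bndc; last first.
  by apply: measurable_funTS; exact: measurable_affine.
rewrite !integral_affine//; last by lra.
rewrite -EFinD lee_fin /c; nra.
Qed.

End area.

(** * The hexagon spanned by the symmetrized triangle *)

Section hexagon_hull.
Context {R : realType}.

(** Convexity in homogeneous form; as [C] contains the origin, [a + b] may be less than
    [r]. *)
Lemma convex_combination n (C : set 'rV[R]_n) p q (a b r : R) : convex C -> C 0 -> C p -> C q ->
  0 <= a -> 0 <= b -> a + b <= r -> exists2 w, C w & a *: p + b *: q = r *: w.
Proof.
move=> xC C0 Cp Cq a0 b0 abr.
have [ab0|ab0] := eqVneq (a + b) 0.
  have [-> ->] : a = 0 /\ b = 0 by split; lra.
  by exists 0; rewrite // !scale0r scaler0 addr0.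
have ab : 0 < a + b by rewrite lt_neqAle eq_sym ab0 addr_ge0.
have r0 : 0 < r by exact: lt_le_trans abr.
have Cw : C ((a / (a + b)) *: p + (1 - a / (a + b)) *: q).
  by apply: xC => //; rewrite divr_ge0 ?addr_ge0//= ler_pdivrMr// mul1r lerDl.
exists (((a + b) / r) *: ((a / (a + b)) *: p + (1 - a / (a + b)) *: q)).
  rewrite -[X in C X]addr0 -(scaler0 _ (1 - (a + b) / r)); apply: xC => //.
  by rewrite divr_ge0 ?(ltW r0) ?addr_ge0//= ler_pdivrMr// mul1r.
rewrite scalerA mulrCA divff ?gt_eqF// mulr1 scalerDr !scalerA; congr (_ *: _ + _ *: _).
  by rewrite mulrCA divff// mulr1.
by field.
Qed.

Lemma row2E (x : 'rV[R]_2) : x = x 0 0 *: delta_mx 0 0 + x 0 1 *: delta_mx 0 1.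
Proof.
by rewrite {1}[x]row_sum_delta big_ord_recl big_ord1; congr (_ + x 0 _ *: delta_mx 0 _); exact: val_inj.
Qed.

(** The vertices [a] of the triangle satisfy both hypotheses on [a], since the ray from
    [a] through the centroid [0] leaves the triangle at [- a / 2]. So [C] contains the
    vertices of the hexagon, and [x] lies in the sector spanned by two adjacent ones. *)
Lemma hexagon_hull2 n (P : 'M[R]_(2, n)) (C : set 'rV[R]_n) r (x : 'rV[R]_2) :
  convex C -> C 0 ->
  (forall a : 'rV[R]_2, gauge triangle_norm a <= 1 -> gauge triangle_norm (- a) <= 2 ->
    C ((5 / 7) *: (a *m P)) /\ C (- ((5 / 7) *: (a *m P)))) ->
  gauge hexagon_norm x <= r -> exists2 p, C p & x *m P = r *: p.
Proof.
move=> xC C0 chord; rewrite /= hexagon_norm_le; set s := x 0 0; set t := x 0 1 => /and3P[sr tr str].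
pose u : 'rV[R]_n := delta_mx 0 0 *m P; pose v : 'rV[R]_n := delta_mx 0 1 *m P.
have -> : x *m P = s *: u + t *: v by rewrite {1}[x]row2E mulmxDl -!scalemxAl.
have entry a b : ((a *: delta_mx 0 0 + b *: delta_mx 0 1 : 'rV[R]_2) 0 0 = a) *
                 ((a *: delta_mx 0 0 + b *: delta_mx 0 1 : 'rV[R]_2) 0 1 = b).
  by rewrite !mxE/= !mulr1 !mulr0 addr0 add0r.
have oppE (y : 'rV[R]_2) k : (- y) 0 k = - y 0 k by rewrite mxE.
have vertex a b : a + b <= 1 -> b - 2 * a <= 1 -> a - 2 * b <= 1 ->
    - a - b <= 2 -> - b + 2 * a <= 2 -> - a + 2 * b <= 2 ->
    C ((5 / 7) *: (a *: u + b *: v)) /\ C ((5 / 7) *: - (a *: u + b *: v)).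
  move=> *; have := chord (a *: delta_mx 0 0 + b *: delta_mx 0 1).
  rewrite scalerN mulmxDl -!scalemxAl -/u -/v; apply.
    by rewrite /= !entry triangle_norm_le; apply/and3P; split; lra.
  rewrite /= !oppE !entry triangle_norm_le; apply/and3P; split; lra.
have [Cu Cu'] := vertex 1 0 ltac:(lra) ltac:(lra) ltac:(lra) ltac:(lra) ltac:(lra) ltac:(lra).
have [Cv Cv'] := vertex 0 1 ltac:(lra) ltac:(lra) ltac:(lra) ltac:(lra) ltac:(lra) ltac:(lra).
have [Cw' Cw] := vertex (-1) (-1) ltac:(lra) ltac:(lra) ltac:(lra) ltac:(lra) ltac:(lra) ltac:(lra).
rewrite !scale0r ?addr0 ?add0r !scale1r in Cu Cu' Cv Cv'.
rewrite !scaleN1r -opprD ?opprK in Cw Cw'.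
clear vertex; clearbody u v.
have comb a b p q : C ((5 / 7) *: p) -> C ((5 / 7) *: q) -> 0 <= a -> 0 <= b ->
    a + b <= 5 / 7 * r -> exists2 w, C w & a *: p + b *: q = r *: w.
  move=> Cp Cq a0 b0 abr.
  have [|||w Cw0 wE] := @convex_combination _ _ _ _ (7 / 5 * a) (7 / 5 * b) r xC C0 Cp Cq; try lra.
  exists w => //; rewrite -wE !scalerA; congr (_ *: _ + _ *: _); by field.
have str1 := le_trans (ler_norm _) str.
have str2 := ler_norm (- (s - t)); rewrite normrN in str2.
have sr1 := le_trans (ler_norm _) sr; have tr1 := le_trans (ler_norm _) tr.
have sr2 := ler_norm (- s); have tr2 := ler_norm (- t); rewrite !normrN in sr2 tr2.
(* One case for each of the six sectors between adjacent vertices. *)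
have [s0|s0] := leP 0 s; have [t0|t0] := leP 0 t.
- have [st|st] := leP t s.
    have [|||w Cw0 wE] := comb t (s - t) _ _ Cw Cu; try lra.
    by exists w => //; rewrite -wE; apply/rowP => k; rewrite !mxE; ring.
  have [|||w Cw0 wE] := comb s (t - s) _ _ Cw Cv; try lra.
  by exists w => //; rewrite -wE; apply/rowP => k; rewrite !mxE; ring.
- have [|||w Cw0 wE] := comb s (- t) _ _ Cu Cv'; try lra.
  by exists w => //; rewrite -wE; apply/rowP => k; rewrite !mxE; ring.
- have [|||w Cw0 wE] := comb (- s) t _ _ Cu' Cv; try lra.
  by exists w => //; rewrite -wE; apply/rowP => k; rewrite !mxE; ring.
- have [st|st] := leP s t.
    have [|||w Cw0 wE] := comb (- t) (t - s) _ _ Cw' Cu'; try lra.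
    by exists w => //; rewrite -wE; apply/rowP => k; rewrite !mxE; ring.
  have [|||w Cw0 wE] := comb (- s) (s - t) _ _ Cw' Cv'; try lra.
  by exists w => //; rewrite -wE; apply/rowP => k; rewrite !mxE; ring.
Qed.

End hexagon_hull.

Section comparison.
Context {R : realType}.

Lemma gauge_cons (phi : R -> R -> R) m s (y : 'rV[R]_m.+2) :
  @gauge R phi m.+1 (cons_row s y) = `|s| + gauge phi y.
Proof. by rewrite /= cons_row0 cons_rowK. Qed.

Lemma gauge_ballS (phi : R -> R -> R) m r s :
  [set y | @gauge_ball _ phi m.+1 r (cons_row s y)] = gauge_ball phi (r - `|s|).
Proof.
by apply/funext => y; rewrite /gauge_ball/= cons_row0 cons_rowK addrC -lerBrDr.
Qed.

(** The sections of both double cones at first coordinate [s] are balls of the same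
    radius [r - `|s|], so the ratio of the plane balls, [75 / 49] over [3 / 2], is
    inherited by all dimensions. *)
Lemma leb_hexagon_triangle m r :
  ((50 / 49)%:E * leb (@gauge_ball R triangle_norm m r) <= leb (@gauge_ball R hexagon_norm m r))%E.
Proof.
elim: m r => [|m IH] r; last first.
  rewrite !(@leb_cons _ m.+2) -lower_integralZ//.
  apply: le_lower_integral => s _; first by rewrite mule_ge0// leb_ge0.
  by rewrite !gauge_ballS.
have [r0|r0] := leP 0 r.
  apply: le_trans (leb_hexagon r0); apply: le_trans (lee_wpmul2l _ (leb_triangle r0)) _ => //.
  by rewrite -EFinM lee_fin; lra.
rewrite (_ : @gauge_ball R triangle_norm 0 r = set0) ?leb0 ?mule0 ?leb_ge0//.
rewrite -subset0 => x /= xr.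
by have := le_trans (gauge_ge0 triangle_normP x) xr; rewrite leNgt r0.
Qed.

Lemma cube_sub_gauge_ball (phi : R -> R -> R) m r : asymmetric_norm phi -> 0 <= r ->
  cube m.+2 (r / (m + 6)%:R) `<=` gauge_ball phi r.
Proof.
move=> phiN r0 x xr; rewrite /gauge_ball/= (le_trans (gauge_le phiN xr))//.
by rewrite mulrCA divff ?mulr1// pnatr_eq0 addn_eq0 andbF.
Qed.

Lemma leb_gauge_ball_gt0 (phi : R -> R -> R) m : asymmetric_norm phi ->
  (0 < leb (@gauge_ball _ phi m 1%R))%E.
Proof.
move=> phiN; have c0 : 0 < 1 / (m + 6)%:R :> R by rewrite divr_gt0// ltr0n addn_gt0 orbT.
apply: (@lt_le_trans _ _ (leb (cube m.+2 (1 / (m + 6)%:R)))).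
  by rewrite leb_cube ?(ltW c0)// lte_fin exprn_gt0// mulr_gt0.
apply: le_leb; [exact: mrow_cube|by apply: compact_mrow; exact: compact_gauge_ball|].
exact: cube_sub_gauge_ball.
Qed.

(** The hypotheses on [a] say that 0-centred chords of the double cone over the triangle
    are kept if they are symmetric, and that those with end points [a] and [- a / 2] are
    replaced by symmetric ones of half length [5 / 7] instead of [3 / 4]. The axes of the
    double cone are symmetric chords; the rest follows by induction. *)
Lemma hexagon_hull m n (P : 'M[R]_(m.+2, n)) (C : set 'rV[R]_n) : convex C -> C 0 ->
  (forall a, gauge triangle_norm a <= 1 -> gauge triangle_norm (- a) <= 2 ->
    C ((5 / 7) *: (a *m P)) /\ C (- ((5 / 7) *: (a *m P)))) ->
  (forall a, gauge triangle_norm a <= 1 -> gauge triangle_norm (- a) <= 1 -> C (a *m P)) ->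
  forall r x, gauge hexagon_norm x <= r -> exists2 p, C p & x *m P = r *: p.
Proof.
move=> xC C0; elim: m P => [|m IH] P chord sym r x xr; first exact: hexagon_hull2 chord xr.
pose P' := dsubmx (P : 'M[R]_(1 + m.+2, n)).
have consM c y : cons_row c y *m P = c *: row 0 P + y *m P'.
  rewrite -[in LHS](@vsubmxK _ 1 m.+2 n P) mul_row_col mul_scalar_mx; congr (_ *: _ + _).
  by apply/rowP => k; rewrite !mxE; congr (P _ _); exact: val_inj.
have consN c (y : 'rV[R]_m.+2) : - cons_row c y = cons_row (- c) (- y).
  by rewrite /cons_row opp_row_mx raddfN.
have gauge0 : gauge triangle_norm (0 : 'rV[R]_m.+2) = 0.
  by rewrite -(scale0r 0) (gaugeZ triangle_normP)// mul0r.
have Ce c : `|c| = 1 -> C (c *: row 0 P).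
  move=> c1; have := sym (cons_row c 0); rewrite consM mul0mx addr0; apply.
    by rewrite gauge_cons c1 gauge0 addr0.
  by rewrite consN gauge_cons normrN c1 oppr0 gauge0 addr0.
have {}IH : forall r x, gauge hexagon_norm x <= r -> exists2 p, C p & x *m P' = r *: p.
  apply: IH => a.
    have := chord (cons_row 0 a); rewrite consM scale0r add0r consN.
    by rewrite !gauge_cons oppr0 !normr0 !add0r.
  have := sym (cons_row 0 a); rewrite consM scale0r add0r consN.
  by rewrite !gauge_cons oppr0 !normr0 !add0r.
rewrite (cons_rowE x) consM; rewrite (cons_rowE x) gauge_cons in xr.
set c := x 0 0 in xr *; set y := rsubmx _ in xr *.
have [|q Cq yE] := IH (r - `|c|) y; first by rewrite lerBrDl.
have y0 := gauge_ge0 hexagon_normP y; have absc0 := normr_ge0 c.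
rewrite yE; have [c0|c0] := eqVneq c 0; first by exists q => //; rewrite c0 scale0r normr0 subr0 add0r.
have {}Ce : C ((c / `|c|) *: row 0 P).
  by apply: Ce; rewrite normrM normfV normr_id divff// normr_eq0.
have [|||w Cw wE] := @convex_combination _ _ C _ q `|c| (r - `|c|) r xC C0 Ce Cq; try lra.
exists w => //; rewrite -wE scalerA mulrCA divff ?mulr1//.
by rewrite normr_eq0.
Qed.

End comparison.

(** * Reflections, thickenings and tubes *)

Section reflection.
Context {R : realType} {n : nat} (H : {vspace 'rV[R]_n}).

Definition reflection_mx : 'M[R]_n := 2 *: oproj_mx H - 1%:M.

Lemma reflectionE : reflection H = fun x => x *m reflection_mx.
Proof.
apply/funext => x; rewrite /reflection oprojE -oproj_mxE.
by rewrite mulmxBr mulmx1 -scalemxAr.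
Qed.

Lemma symmetric_wrtE K : symmetric_wrt H K <-> linear_image reflection_mx K = K.
Proof. by rewrite /symmetric_wrt reflectionE. Qed.

Lemma oproj_mx_idem : oproj_mx H *m oproj_mx H = oproj_mx H.
Proof. by rewrite oproj_mxE mulmxA -(mulmxA _ _ (onbasis H)^T) onbasis_orthonormal mulmx1. Qed.

(** The last condition says that the rows of [P] are orthogonal to [H]. *)
Lemma perp_frame j : (j <= n - \dim H)%N ->
  exists P : 'M[R]_(j, n), row_free P /\ P *m reflection_mx = - P.
Proof.
set K := kermx (onbasis H)^T => jn.
have rK : (j <= \rank K)%N.
  rewrite mxrank_ker mxrank_tr; apply: (leq_trans jn); apply: leq_sub2l.
  exact: rank_leq_row.
pose P := rowsub (widen_ord rK) 1%:M *m row_base K.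
exists P; split.
  rewrite /P -row_leq_rank mxrankMfree ?row_base_free// row_leq_rank.
  apply: orthonormal_row_free; apply: coordinate_orthonormal => a b [ab].
  exact: val_inj.
have PB : P *m (onbasis H)^T = 0.
  rewrite /P -mulmxA (_ : row_base K *m _ = 0) ?mulmx0//.
  by apply/sub_kermxP; rewrite eq_row_base.
by rewrite mulmxBr mulmx1 -scalemxAr oproj_mxE mulmxA PB mul0mx scaler0 sub0r.
Qed.

(** Generators adapted to [H]: each of them is fixed or negated by the reflection. *)
Definition split_basis (i : bool * 'I_n) : 'rV[R]_n :=
  if i.1 then delta_mx 0 i.2 *m oproj_mx H else delta_mx 0 i.2 - delta_mx 0 i.2 *m oproj_mx H.

(** A body that is invariant under the reflection in [H], has interior points, and
    shrinks to a point as [N] grows. As a zonotope, it adds little volume. *)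
Definition thickening (N : nat) : set 'rV[R]_n :=
  zonotope N%:R^-1 [seq split_basis i | i <- enum {: bool * 'I_n}].

Definition thicken (A : set 'rV[R]_n) N := minkowski_sum A (thickening N).

Lemma thickening_invariant N : linear_image reflection_mx (thickening N) = thickening N.
Proof.
apply: zonotope_invariant => _ /mapP[[[] k] _ ->]; rewrite /split_basis/= mulmxBr mulmx1 -scalemxAr.
  by left; rewrite -mulmxA oproj_mx_idem scaler_nat mulr2n addrK.
by right; rewrite mulmxBl -mulmxA oproj_mx_idem subrr scaler0 sub0r.
Qed.

Lemma cube_sub_thickening N : cube n N%:R^-1 `<=` thickening N.
Proof.
move=> x xN; rewrite /thickening.
have -> : x = \sum_(i <- enum {: bool * 'I_n}) x 0 i.2 *: split_basis i.
  rewrite big_enum/= -(pair_bigA _ (fun b k => x 0 k *: split_basis (b, k)))/=.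
  rewrite big_bool -big_split/= {1}[x]row_sum_delta; apply: eq_bigr => k _.
  by rewrite -scalerDr addrC subrK.
exact: zonotope_combination.
Qed.

Lemma thickening0 N : thickening N 0.
Proof. by apply: zonotope0; rewrite invr_ge0. Qed.

Lemma thickening_le N N' : (0 < N <= N')%N -> thickening N' `<=` thickening N.
Proof.
move=> /andP[N0 NN']; apply: zonotope_le; rewrite lef_pV2 ?posrE ?ltr0n ?ler_nat//.
exact: leq_trans NN'.
Qed.

Lemma thicken_sub A N : A `<=` thicken A N.
Proof. by move=> a Aa; exists a => //; exists 0; [exact: thickening0|rewrite addr0]. Qed.

Lemma thickening_sub A N : A 0 -> thickening N `<=` thicken A N.
Proof. by move=> A0 z Dz; exists 0 => //; exists z => //; rewrite add0r. Qed.

Lemma convex_body_thicken A N : A !=set0 -> compact A -> convex A -> (0 < N)%N ->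
  convex_body (thicken A N).
Proof.
move=> [a Aa] cA xA N0; split; first split.
- by exists a; exact: thicken_sub.
- by apply: compact_minkowski_sum => //; exact: compact_zonotope.
- by apply/convexE; apply: convex_minkowski_sum => //; exact: convex_zonotope.
exists a; apply/nbhs_ballP; exists N%:R^-1 => /=; first by rewrite invr_gt0 ltr0n.
move=> y; rewrite -ball_normE/= distrC => /ltW ay; exists a => //.
exists (y - a); last by rewrite addrC subrK.
by apply: cube_sub_thickening; apply/cubeE => //; rewrite invr_ge0.
Qed.

Lemma symmetric_thicken j (P : 'M[R]_(j, n)) X N : P *m reflection_mx = - P ->
  (forall x, X x -> X (- x)) -> symmetric_wrt H (thicken (linear_image P X) N).
Proof.
move=> PS XN; apply/symmetric_wrtE.
rewrite linear_image_sum thickening_invariant linear_image_comp PS; congr minkowski_sum.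
apply/seteqP; split=> _ [x Xx <-]; exists (- x); rewrite ?mulmxN ?mulNmx ?opprK//; exact: XN.
Qed.

(** The zonotopes of size [N%:R^-1] are scaled copies of the one of size [1]. *)
Lemma thickening_small e : 0 < e -> exists2 N0, (0 < N0)%N &
  forall N z, (N0 <= N)%N -> thickening N z -> `|z| <= e.
Proof.
move=> e0; set vs := [seq split_basis i | i <- enum {: bool * 'I_n}].
have [c c0 Zc] := compact_sub_cube (@compact_zonotope R n 1 vs).
have scale d z : 0 < d -> zonotope d vs z -> zonotope 1 vs (d^-1 *: z).
  move=> d0; elim: {Zc} vs z => [|v us IH] z /=; first by move=> ->; rewrite scaler0.
  move=> [a Za [_ [t /andP[t0 t1] <-] <-]]; exists (d^-1 *: a); first exact: IH.
  exists ((d^-1 * t) *: v); last by rewrite scalerDr scalerA.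
  exists (d^-1 * t) => //=; rewrite mulrC ler_pdivlMr// ler_pdivrMr// mulN1r mul1r.
  by rewrite t0.
have [N NE] := invS_lt (divr_gt0 e0 c0); exists N.+1 => // N' z NN'.
have N'0 : 0 < N'%:R^-1 :> R by rewrite invr_gt0 ltr0n (leq_trans _ NN').
move=> /(scale _ _ N'0)/Zc/(cubeE _ (ltW c0)); rewrite normrZ normfV gtr0_norm// invrK.
rewrite mulrC -ler_pdivlMr ?ltr0n ?(leq_trans _ NN')// => /le_trans; apply.
rewrite mulrC -ler_pdivlMr//; apply: le_trans (ltW NE).
by rewrite lef_pV2 ?posrE ?ltr0n ?ler_nat// (leq_trans _ NN').
Qed.

End reflection.

Section tube.
Context {R : realType}.

Definition tube k (p q e : R) : set 'rV[R]_(1 + k) :=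
  [set x : 'rV[R]_(1 + k) | - p <= x 0 0 <= q /\ cube k e (rsubmx x)].

Lemma leb_tube k p q e : 0 <= p + q -> 0 <= e ->
  leb (@tube k p q e) = ((p + q) * (2 * e) ^+ k)%:E.
Proof.
move=> pq e0; rewrite (_ : tube _ _ _ = [set x : 'rV[R]_(1 + k) |
    `[- p, q]%classic (x 0 0) /\ cube k e (rsubmx x)]).
  rewrite (leb_prod (A := `[- p, q]%classic)); [|exact: measurable_itv|exact: mrow_cube].
  rewrite leb_cube// lebesgue_measure_itv/= lte_fin EFinM; congr (_ * _)%E.
  case: ltP => pq'; first by rewrite -EFinB; congr EFin; ring.
  by congr EFin; lra.
by apply/seteqP; split=> x [/= + xc]; rewrite ?in_itv/=; split=> //=; rewrite ?in_itv.
Qed.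

Lemma tubeE k p q e : @tube k p q e =
  minkowski_sum (segment (- p) q (cons_row 1 0)) (linear_image (row_mx 0 1%:M) (cube k e)).
Proof.
have E s (y : 'rV[R]_k) : s *: cons_row 1 0 + y *m row_mx 0 1%:M = cons_row s y.
  rewrite mul_mx_row mulmx0 mulmx1 /cons_row scale_row_mx add_row_mx scaler0 add0r addr0.
  by rewrite scale_scalar_mx mulr1.
apply/seteqP; split=> [x [xpq xe]|_ [_ [t tpq <-] [_ [y ye <-] <-]]].
  exists (x 0 0 *: cons_row 1 0); first by exists (x 0 0).
  by exists (rsubmx x *m row_mx 0 1%:M); [exists (rsubmx x)|rewrite E -cons_rowE].
by rewrite E; split; rewrite ?cons_row0 ?cons_rowK.
Qed.

Lemma compact_tube k p q e : compact (@tube k p q e).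
Proof.
rewrite tubeE; apply: compact_minkowski_sum; first exact: compact_segment.
exact/compact_linear_image/compact_cube.
Qed.

Lemma convex_tube k p q e : convex (@tube k p q e).
Proof.
rewrite tubeE; apply: convex_minkowski_sum; first exact: convex_segment.
exact/convex_linear_image/convex_cube.
Qed.

Lemma tube_opp k p e x : @tube k p p e x -> tube p p e (- x).
Proof.
move=> [/andP[xp px] xe]; split; first by rewrite mxE; apply/andP; split; lra.
by move=> l; have := xe l; rewrite !mxE normrN.
Qed.

Lemma tube_le k p q p' q' e e' : p <= p' -> q <= q' -> e <= e' ->
  @tube k p q e `<=` tube p' q' e'.
Proof.
move=> pp qq ee x [/andP[xp xq] xe]; split; first by apply/andP; split; lra.
by move=> l; exact: le_trans (xe l) ee.
Qed.

Lemma tube0 k p q e : 0 <= p -> 0 <= q -> 0 <= e -> @tube k p q e 0.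
Proof.
move=> p0 q0 e0; split; first by rewrite mxE q0 andbT oppr_le0.
by move=> l; rewrite !mxE normr0.
Qed.

End tube.

(** * Symmetrizations *)

(** The class [B] may be any class between the convex bodies and the compact convex
    sets. *)
Section symmetrization.
Context {R : realType} {n m : nat} (H : {vspace 'rV[R]_n}).
Variable sigma : probability (borel_subspaces R n) R.
Variables (B : set (set 'rV[R]_n)) (F : set 'rV[R]_n -> set 'rV[R]_n).
Hypothesis (jn : (m.+2 <= n)%N) (haar : haar_grassmannian m.+2 sigma).
Hypothesis bodyB : forall K, convex_body K -> B K.
Hypothesis compactB : forall K, B K -> compact_convex K.
Hypothesis symF : symmetrization B H F.
Hypothesis monoF : monotonic B F.
Hypothesis invF : invariant_on_symmetric B H F.
Hypothesis presF : preserving (intrinsic_volume sigma m.+2) B F.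
Local Notation V := (intrinsic_volume sigma m.+2).
Local Notation S := (reflection_mx H).
Local Notation thicken := (thicken H).

Lemma compact_image K : convex_body K -> compact (F K).
Proof. by move=> /bodyB/symF[/compactB[]]. Qed.

Lemma convex_image K : convex_body K -> convex (F K).
Proof. by move=> /bodyB/symF[/compactB[_ _ /convexE]]. Qed.

Lemma reflect_image K x : convex_body K -> F K x -> F K (x *m S).
Proof.
by move=> /bodyB/symF[_ /symmetric_wrtE FS] Kx; rewrite -FS; exists x.
Qed.

Lemma image_mono K L : convex_body K -> convex_body L -> K `<=` L -> F K `<=` F L.
Proof. by move=> bK bL; apply: monoF; exact: bodyB. Qed.

Lemma image_symmetric K : convex_body K -> symmetric_wrt H K -> F K = K.
Proof. by move=> bK; apply: invF; exact: bodyB. Qed.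

(** The thickening is a symmetric body around the origin, hence fixed by [F]. *)
Lemma image0 K N : (0 < N)%N -> convex_body K -> thickening H N `<=` K -> F K 0.
Proof.
move=> N0 bK DK.
have E : thicken (linear_image (0 : 'M[R]_(1, n)) setT) N = thickening H N.
  apply/seteqP; split=> [_ [_ [x _ <-] [z Dz <-]]|z Dz]; first by rewrite mulmx0 add0r.
  by exists 0; [exists 0; rewrite ?mulmx0|exists z => //; rewrite add0r].
have bD : convex_body (thickening H N).
  rewrite -E; apply: convex_body_thicken => //.
  - by exists 0, 0; rewrite ?mulmx0.
  - rewrite (_ : linear_image _ _ = [set 0]); first exact: compact_set1.
    by apply/seteqP; split=> [_ [x _ <-]|_ ->]; rewrite /= ?mulmx0//; exists 0; rewrite ?mulmx0.
  - by apply: convex_linear_image.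
apply: (image_mono bD bK DK); rewrite image_symmetric//; first exact: thickening0.
by rewrite -E; apply: symmetric_thicken => //; rewrite mul0mx oppr0.
Qed.

Lemma tube_body (Q : 'M[R]_(1 + m.+1, n)) p q e N : 0 <= p -> 0 <= q -> 0 <= e -> (0 < N)%N ->
  convex_body (thicken (linear_image Q (tube p q e)) N).
Proof.
move=> p0 q0 e0 N0; apply: convex_body_thicken => //.
- by exists (0 *m Q), 0; [exact: tube0|].
- exact/compact_linear_image/compact_tube.
- exact/convex_linear_image/convex_tube.
Qed.

(** The symmetric tube over [[- q, q]] contains the given one and is fixed by [F], so it
    contains the image. If [b <= x 0 0] failed on the image, then by symmetry the image
    would lie in the tube over [[- b, b]], which has less volume than the one over
    [[- p, q]]; for large [N] the thickening does not make up for the difference. *)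
Lemma far_point (Q : 'M[R]_(1 + m.+1, n)) p q b e : row_free Q -> Q *m S = - Q ->
  0 <= p <= q -> 0 < e -> 0 <= b < (p + q) / 2 ->
  exists2 N0, (0 < N0)%N & forall N, (N0 <= N)%N -> exists x z,
    [/\ tube q q e x, b <= x 0 0, thickening H N z
      & F (thicken (linear_image Q (tube p q e)) N) (x *m Q + z)].
Proof.
move=> fQ QS /andP[p0 pq] e0 /andP[b0 bpq].
have q0 : 0 <= q by exact: le_trans pq.
have [k k0 Vk] := intrinsic_volume_linear (P := Q) jn haar fQ.
have cT r s : compact (linear_image Q (@tube _ m.+1 r s e)).
  exact/compact_linear_image/compact_tube.
have xT r s : convex (linear_image Q (@tube _ m.+1 r s e)).
  exact/convex_linear_image/convex_tube.
have [c c0 cP] := intrinsic_volume_add_zonotope sigma (j := m.+2)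
  [seq split_basis H i | i <- enum {: bool * 'I_n}] (cT b b) (xT b b).
pose d := k * ((p + q - 2 * b) * (2 * e) ^+ m.+1).
have d0 : 0 < d by rewrite !mulr_gt0// ?exprn_gt0 ?mulr_gt0//; lra.
have c10 : 0 < c + 1 by rewrite ltr_wpDl.
have [N0 N0P] := invS_lt (divr_gt0 d0 c10); exists N0.+1 => // N N0N.
have N_gt0 : (0 < N)%N by exact: leq_trans N0N.
apply: contrapT => far; pose K := thicken (linear_image Q (tube p q e)) N.
have bK : convex_body K by apply: tube_body => //; exact: ltW.
have bL : convex_body (thicken (linear_image Q (tube q q e)) N) by apply: tube_body => //; exact: ltW.
have FKL : F K `<=` thicken (linear_image Q (tube q q e)) N.
  rewrite -(image_symmetric bL); last exact: symmetric_thicken (@tube_opp _ _ _ _).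
  apply: image_mono => //; apply: minkowski_sumS => // _ [x xt <-]; exists x => //.
  exact: tube_le xt.
have sub : F K `<=` thicken (linear_image Q (tube b b e)) N.
  move=> y Ky; have [_ [x xt <-] [z Dz yE]] := FKL _ Ky.
  have xb : x 0 0 < b.
    by rewrite ltNge; apply/negP => bx; apply: far; exists x, z; split=> //; rewrite yE.
  have xb' : - x 0 0 < b.
    rewrite ltNge; apply/negP => bx; apply: far; exists (- x), (z *m S); split.
    - exact: tube_opp.
    - by rewrite mxE.
    - by rewrite -(thickening_invariant H N); exists z.
    - have := reflect_image bK Ky; rewrite -yE mulmxDl -mulmxA QS.
      by rewrite mulNmx mulmxN.
  exists (x *m Q); last by exists z.
  exists x => //; have [_ xe] := xt; split=> //; apply/andP; split; lra.
have cD r s : compact (thicken (linear_image Q (@tube _ m.+1 r s e)) N).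
  by apply: compact_minkowski_sum => //; exact: compact_zonotope.
have := le_intrinsic_volume (j := m.+2) sigma (compact_image bK) (cD b b) sub.
rewrite presF; last exact: bodyB.
apply/negP; rewrite -ltNge; apply: (le_lt_trans (cP N N_gt0)).
apply: (@lt_le_trans _ _ (V (linear_image Q (tube p q e)))); last first.
  exact: (le_intrinsic_volume (j := m.+2) sigma (cT p q) (cD p q) (@thicken_sub _ _ _ _ _)).
rewrite !Vk; [|exact: compact_tube..].
rewrite !leb_tube ?(ltW e0) ?addr_ge0// -!EFinM -EFinD lte_fin.
have cN : c / N%:R < d.
  apply: (@le_lt_trans _ _ ((c + 1) * N%:R^-1)).
    by rewrite ler_wpM2r ?invr_ge0// lerDl.
  rewrite mulrC -ltr_pdivlMr//; apply: le_lt_trans N0P.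
  by rewrite lef_pV2 ?posrE ?ltr0n// ler_nat.
rewrite -ltrBrDl; apply: (lt_le_trans cN); rewrite /d -mulrBr -mulrBl.
by rewrite (_ : p + q - 2 * b = p + q - (b + b))//; ring.
Qed.

(** Thinner tubes and smaller thickenings are in [K] too, and their far points approach
    the axis of the tube beyond [b]. Pulled back towards [0] by a factor at most [1], they
    stay in the convex set [F K] and converge to the point of the axis at [b]; and [F K]
    is closed. *)
Lemma chord_point (Q : 'M[R]_(1 + m.+1, n)) p q b e N K : row_free Q -> Q *m S = - Q ->
  0 <= p <= q -> 0 < e -> 0 <= b < (p + q) / 2 -> (0 < N)%N -> convex_body K ->
  thicken (linear_image Q (tube p q e)) N `<=` K ->
  F K (b *: (cons_row 1 0 *m Q)).
Proof.
move=> fQ QS pq e0 /andP[b0 bpq] N_gt0 bK TK.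
have /andP[p0 pq'] := pq; have q0 : 0 <= q by exact: le_trans pq'.
have FK0 : F K 0.
  apply: (image0 N_gt0) => // z Dz; apply: TK; exists 0; last by exists z => //; rewrite add0r.
  by exists 0; [apply: tube0 => //; exact: ltW|rewrite mul0mx].
move: b0; rewrite le_eqVlt => /predU1P[<-|b0]; first by rewrite scale0r.
have clF : closed (F K) by apply: compact_closed; [exact: norm_hausdorff|exact: compact_image].
apply: clF => U /nbhs_ballP[d /= d0 dU].
pose e' := Num.min e (d / 4 / ((m.+2)%:R * (`|Q| + 1))).
have e'0 : 0 < e' by rewrite lt_min e0 !divr_gt0// mulr_gt0// ltr_wpDl.
have d40 : 0 < d / 4 by rewrite divr_gt0.
have [N1 N1_gt0 N1P] := thickening_small H d40.
have bpq' : 0 <= b < (p + q) / 2 by rewrite ltW.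
have [N2 N2_gt0 N2P] := far_point fQ QS pq e'0 bpq'.
pose N' := maxn N (maxn N1 N2).
have [|x [z [[_ xe] bx Dz Fxz]]] := N2P N'; first by rewrite !leq_max leqnn !orbT.
have N'_gt0 : (0 < N')%N by rewrite !leq_max N_gt0.
have FKxz : F K (x *m Q + z).
  apply: image_mono Fxz => //; first by apply: tube_body => //; exact: ltW.
  apply: subset_trans TK; apply: minkowski_sumS.
    by move=> _ [y yt <-]; exists y => //; apply: tube_le yt => //; rewrite ge_min lexx.
  by apply: thickening_le; rewrite N_gt0 leq_max leqnn.
set s := x 0 0 in bx *; have s0 : 0 < s by exact: lt_le_trans bx.
have bs : 0 <= b / s <= 1 by rewrite divr_ge0 ?(ltW s0) ?(ltW b0)//= ler_pdivrMr// mul1r.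
exists ((b / s) *: (x *m Q + z)); split.
  by have := convex_image bK FKxz FK0 bs; rewrite scaler0 addr0.
apply: dU; rewrite -ball_normE/=.
set y := rsubmx x in xe.
have xQ : x *m Q = s *: (cons_row 1 0 *m Q) + cons_row 0 y *m Q.
  rewrite {1}[x]cons_rowE -/s -/y scalemxAl -mulmxDl; congr (_ *m _).
  by rewrite /cons_row scale_row_mx add_row_mx scaler0 add0r scale_scalar_mx mulr1 raddf0 addr0.
have -> : b *: (cons_row 1 0 *m Q) - (b / s) *: (x *m Q + z) =
    (b / s) *: - (cons_row 0 y *m Q + z).
  by rewrite xQ -addrA scalerDr scalerA divfK ?gt_eqF// opprD addrA subrr add0r scalerN.
rewrite normrZ ger0_norm; last by case/andP: bs.
apply: (@le_lt_trans _ _ `|cons_row 0 y *m Q + z|).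
  by rewrite normrN ler_piMl//; case/andP: bs.
have wd : `|cons_row 0 y *m Q| <= d / 4.
  have cy : cube (1 + m.+1) e' (cons_row 0 y).
    move=> l; rewrite mxE; case: splitP => l' _; last exact: xe.
    by rewrite mxE mul0rn normr0 ltW.
  have := linear_image_cube (ltW e'0) (entry_le_norm Q) (imageP _ cy).
  move=> /cubeE; rewrite !mulr_ge0 ?(ltW e'0)// => /(_ isT)/le_trans; apply.
  rewrite mulrCA; apply: (@le_trans _ _ (e' * ((m.+2)%:R * (`|Q| + 1)))).
    by rewrite ler_wpM2l ?(ltW e'0)// ler_wpM2l// lerDl.
  by rewrite -ler_pdivlMr ?mulr_gt0 ?ltr_wpDl// ge_min lexx orbT.
have zd : `|z| <= d / 4 by apply: N1P Dz; rewrite !leq_max leqnn !orbT.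
apply: le_lt_trans (ler_normD _ _) _; lra.
Qed.

Lemma unit_first_row k (a : 'rV[R]_(1 + k)) : a != 0 ->
  exists2 M : 'M[R]_(1 + k), M \in unitmx & cons_row 1 0 *m M = a.
Proof.
move=> a0; have ra : \rank a = 1%N by apply/eqP; rewrite eqn_leq rank_leq_row lt0n mxrank_eq0.
pose c := col_ebase a 0 0; have cE : col_ebase a = c%:M by exact: mx11_scalar.
have c0 : c != 0.
  by have := col_ebase_unit a; rewrite cE unitmxE det_scalar1 unitfE.
exists (c *: row_ebase a).
  by rewrite -mul_scalar_mx unitmx_mul row_ebase_unit unitmxE det_scalar unitfE expf_eq0 (negbTE c0) andbF.
rewrite -[RHS]mulmx_ebase ra cE mul_scalar_mx -scalemxAr -scalemxAl; congr (_ *: (_ *m _)).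
apply/matrixP => i l; rewrite !ord1 mxE; case: splitP => l' ll'.
  by rewrite !mxE !ord1 eqxx ll' ord1.
by rewrite !mxE ll'.
Qed.

(** The chord in direction [a] contains [[- 1 / 2, 1]], with half length [3 / 4]. Shrunk
    by [48 / 49], it leaves room of [1 / 49] in the gauge for a tube around it, and its half
    length [36 / 49] still exceeds [5 / 7]. *)
Lemma triangle_chord (P : 'M[R]_(m.+2, n)) N K a : row_free P -> P *m S = - P ->
  (0 < N)%N -> convex_body K ->
  thicken (linear_image P (gauge_ball triangle_norm 1)) N `<=` K ->
  gauge triangle_norm a <= 1 -> gauge triangle_norm (- a) <= 2 ->
  F K ((5 / 7) *: (a *m P)).
Proof.
move=> fP PS N_gt0 bK TK a1 a2; have TN := @triangle_normP R.
have [->|a0] := eqVneq a 0.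
  rewrite mul0mx scaler0; apply: (image0 N_gt0) => // z Dz; apply: TK.
  exists 0; last by exists z => //; rewrite add0r.
  by exists 0; rewrite ?mul0mx// /gauge_ball/= -(scale0r 0) gaugeZ// mul0r.
have [M uM Ma] := @unit_first_row m.+1 a a0; rewrite -Ma -mulmxA.
have QS : M *m P *m S = - (M *m P) by rewrite -mulmxA PS mulmxN.
have fQ : row_free (M *m P).
  by rewrite -row_leq_rank mxrankMfree// row_leq_rank row_free_unit.
pose e := 49^-1 / ((m + 6)%:R * (m.+2%:R * (`|M| + 1))) : R.
have e0 : 0 < e.
  by rewrite !divr_gt0 ?invr_gt0// !mulr_gt0 ?ltr0n ?addn_gt0 ?orbT// ltr_wpDl.
apply: (@chord_point _ (24 / 49) (48 / 49) _ e N) => //.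
- by apply/andP; split; lra.
- by apply/andP; split; lra.
apply: subset_trans TK; apply: minkowski_sumS => // _ [x [/andP[xl xu] xe] <-].
exists (x *m M); last by rewrite mulmxA.
set s := x 0 0 in xl xu; set y := rsubmx x in xe.
have xM : x *m M = s *: a + cons_row 0 y *m M.
  rewrite {1}[x]cons_rowE -/s -/y -Ma scalemxAl -mulmxDl; congr (_ *m _).
  by rewrite /cons_row scale_row_mx add_row_mx scaler0 add0r scale_scalar_mx mulr1 raddf0 addr0.
rewrite /gauge_ball/= xM (le_trans (gaugeD TN _ _))//.
have sa : gauge triangle_norm (s *: a) <= 48 / 49.
  have [s0|s0] := leP 0 s.
    by rewrite gaugeZ//; apply: (le_trans (ler_wpM2l s0 a1)); lra.
  have s0' : 0 <= - s by rewrite oppr_ge0 ltW.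
  rewrite -[s *: a]opprK -scaleNr -scalerN gaugeZ//.
  by apply: (le_trans (ler_wpM2l s0' a2)); lra.
have : gauge triangle_norm (cons_row 0 y *m M) <= 49^-1.
  have cy : cube (1 + m.+1) e (cons_row 0 y).
    move=> l; rewrite mxE; case: splitP => l' _; last exact: xe.
    by rewrite mxE mul0rn normr0 ltW.
  have := linear_image_cube (ltW e0) (entry_le_norm M) (imageP _ cy).
  move=> /(gauge_le TN)/le_trans; apply.
  apply: (@le_trans _ _ (e * ((m + 6)%:R * (m.+2%:R * (`|M| + 1))))).
    rewrite (mulrCA _ e) (mulrCA _ e) ler_wpM2l ?(ltW e0)// ler_wpM2l//.
    by rewrite ler_wpM2l// lerDl.
  by rewrite /e divfK// gt_eqF// !mulr_gt0 ?ltr0n ?addn_gt0 ?orbT// ltr_wpDl.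
lra.
Qed.

(** The segment from [- a] to [a] is symmetric, so the thickened segment is fixed by [F]. *)
Lemma triangle_segment (P : 'M[R]_(m.+2, n)) N K a : P *m S = - P ->
  (0 < N)%N -> convex_body K ->
  thicken (linear_image P (gauge_ball triangle_norm 1)) N `<=` K ->
  gauge triangle_norm a <= 1 -> gauge triangle_norm (- a) <= 1 -> F K (a *m P).
Proof.
move=> PS N_gt0 bK TK a1 a2; pose X := segment (-1) 1 a.
have X1 : X a by exists 1; rewrite ?scale1r//= lexx andbT; lra.
have bX : convex_body (thicken (linear_image P X) N).
  apply: convex_body_thicken => //.
  - by exists (a *m P), a.
  - exact/compact_linear_image/compact_segment.
  - exact/convex_linear_image/convex_segment.
have XK : thicken (linear_image P X) N `<=` K.
  apply: subset_trans TK; apply: minkowski_sumS => // _ [_ [t /andP[t0 t1] <-] <-].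
  exists (t *: a) => //; rewrite /gauge_ball/=.
  have [tp|tn] := leP 0 t.
    by rewrite (gaugeZ triangle_normP)//; apply: (le_trans (ler_wpM2l tp a1)); lra.
  have tn' : 0 <= - t by rewrite oppr_ge0 ltW.
  rewrite -[t *: a]opprK -scaleNr -scalerN (gaugeZ triangle_normP)//.
  by apply: (le_trans (ler_wpM2l tn' a2)); lra.
apply: (image_mono bX bK XK); rewrite image_symmetric//.
  by apply: thicken_sub; exists a.
apply: symmetric_thicken => // _ [t /andP[t0 t1] <-]; exists (- t); last by rewrite scaleNr.
by apply/andP; split; lra.
Qed.

Lemma hexagon_sub_image (P : 'M[R]_(m.+2, n)) N : row_free P -> P *m S = - P -> (0 < N)%N ->
  linear_image P (gauge_ball hexagon_norm 1) `<=`
    F (thicken (linear_image P (gauge_ball triangle_norm 1)) N).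
Proof.
move=> fP PS N_gt0; set K := thicken _ N.
have T0 : gauge_ball triangle_norm 1 (0 : 'rV[R]_m.+2).
  by rewrite /gauge_ball/= -(scale0r 0) (gaugeZ triangle_normP)// mul0r.
have bK : convex_body K.
  apply: convex_body_thicken => //.
  - by exists (0 *m P), 0.
  - by apply: compact_linear_image; exact: (compact_gauge_ball triangle_normP).
  - by apply: convex_linear_image; exact: (convex_gauge_ball triangle_normP).
move=> _ [x xH <-].
have [||||p Fp ->] := hexagon_hull (C := F K) (P := P) _ _ _ _ xH; last by rewrite scale1r.
- exact: convex_image.
- by apply: (image0 N_gt0 bK); apply: thickening_sub; exists 0; rewrite ?mul0mx.
- move=> a a1 a2; have Fa := triangle_chord fP PS N_gt0 bK (@subset_refl _ _) a1 a2.
  by split=> //; have := reflect_image bK Fa; rewrite -scalemxAl -mulmxA PS mulmxN scalerN.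
- by move=> a a1 a2; exact: (triangle_segment PS N_gt0 bK (@subset_refl _ _)).
Qed.

(** With [t] and [g] the volumes of the double cones over the triangle and the hexagon,
    [50 / 49 * k * t <= k * g <= k * t + c / N%:R] for all positive [N]. *)
Lemma no_symmetrization (P : 'M[R]_(m.+2, n)) : row_free P -> P *m S = - P -> False.
Proof.
move=> fP PS; pose T : set 'rV[R]_m.+2 := gauge_ball triangle_norm 1.
pose G : set 'rV[R]_m.+2 := gauge_ball hexagon_norm 1.
have cT : compact T by exact: (compact_gauge_ball triangle_normP).
have cG : compact G by exact: (compact_gauge_ball hexagon_normP).
have xT : convex T by exact: (convex_gauge_ball triangle_normP).
have T_0 : T 0 by rewrite /T/gauge_ball/= -(scale0r 0) (gaugeZ triangle_normP)// mul0r.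
have sub N : (0 < N)%N -> linear_image P G `<=` F (thicken (linear_image P T) N).
  exact: hexagon_sub_image.
have T0 : (0 < leb T)%E by exact: leb_gauge_ball_gt0 triangle_normP.
have TG : ((50 / 49)%:E * leb T <= leb G)%E by exact: leb_hexagon_triangle.
clearbody T G.
have [k k0 Vk] := intrinsic_volume_linear (P := P) jn haar fP.
have [c c0 cP] := intrinsic_volume_add_zonotope sigma (j := m.+2)
  [seq split_basis H i | i <- enum {: bool * 'I_n}]
  (compact_linear_image (M := P) cT) (convex_linear_image (M := P) xT).
have [t tE] : exists t, leb T = t%:E by exists (fine (leb T)); rewrite fineK// leb_fin.
have [g gE] : exists g, leb G = g%:E by exists (fine (leb G)); rewrite fineK// leb_fin.
have VT : V (linear_image P T) = (k * t)%:E by rewrite EFinM -tE; exact: Vk.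
have VG : V (linear_image P G) = (k * g)%:E by rewrite EFinM -gE; exact: Vk.
have t0 : 0 < t by move: T0; rewrite tE lte_fin.
have tg : 50 / 49 * t <= g by rewrite -lee_fin EFinM -tE -gE.
have GT N : (0 < N)%N -> k * g <= k * t + c / N%:R.
  move=> N0; have bK : convex_body (thicken (linear_image P T) N).
    apply: convex_body_thicken => //.
    - by exists (0 *m P), 0.
    - exact: compact_linear_image.
    - exact: convex_linear_image.
  have := sub N N0.
  move=> /(le_intrinsic_volume (j := m.+2) sigma (compact_linear_image cG) (compact_image bK)).
  rewrite presF; last exact: bodyB.
  move=> GK; rewrite -lee_fin EFinD -VT -VG.
  exact: le_trans GK (cP N N0).
have d0 : 0 < k * t / 49 by rewrite divr_gt0 ?mulr_gt0.
have [N NP] := invS_lt (divr_gt0 d0 (ltr_wpDl c0 (@ltr01 R))).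
have := GT N.+1 isT; have : k * (50 / 49 * t) <= k * g.
  by rewrite ler_wpM2l// ltW.
have : c / N.+1%:R < k * t / 49.
  apply: (@le_lt_trans _ _ ((c + 1) * N.+1%:R^-1)).
    by rewrite ler_wpM2r ?invr_ge0// lerDl.
  by rewrite mulrC -ltr_pdivlMr// ltr_wpDl.
rewrite mulrCA; move: (k * _) (k * _) (c / _) => u v w; lra.
Qed.

End symmetrization.

Theorem theorem4p1 (R : realType) (n i j : nat)
  (hi : (i < n)%N) (hj : (2 <= j <= n)%N) (hij : (j <= n - i)%N)
  (H : {vspace 'rV[R]_n}) (hH : \dim H = i)
  (sigma : probability (borel_subspaces R n) R)
  (hsigma : haar_grassmannian j sigma)
  (B : set (set 'rV[R]_n)) (hB : B = compact_convex \/ B = convex_body) :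
  ~ exists F : set 'rV[R]_n -> set 'rV[R]_n,
      [/\ symmetrization B H F,
          monotonic B F,
          invariant_on_symmetric B H F
        & preserving (intrinsic_volume sigma j) B F].
Proof.
move=> [F [symF monoF invF presF]].
case: j hj hij hsigma presF => [//|[//|m]] /andP[_ jn] hij hsigma presF.
rewrite -hH in hij; have [P [fP PS]] := perp_frame hij.
apply: (@no_symmetrization _ _ _ _ sigma B F jn hsigma _ _ symF monoF invF presF P fP PS).
- by case: hB => -> // K [].
- by case: hB => -> // K [].
Qed.
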